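(* For any $p\in(1,3/2)\cup(3,\infty)$ there exist an $\alpha>1$ and a function $a\in\mathfrak{A}(1,\alpha)$ such that, for any $N\in(0,\infty)$, the estimate $$\|u_{xx}\|_{L_p(Q)}\le N\,\|u_t-(\lambda a+1-\lambda)u_{xx}\|_{L_p(Q)}$$ fails to hold on the set of all pairs $(u,\lambda)\in\overset{0}{W}{}^{1,2}_p(Q)\times[0,1]$ (that is, for every $N\in(0,\infty)$ there is a pair $(u,\lambda)$ in this set for which the inequality is false).
   Context: $Q=(0,1)\times\mathbb{R}$, with points written $(t,x)$. For $0<\beta\le\alpha<\infty$, $\mathfrak{A}(\beta,\alpha)$ is the set of Borel functions $a(t,x)$ on $Q$ with $\beta\le a(t,x)\le\alpha$ for all $(t,x)\in Q$. For $p\in(1,\infty)$, $W^{1,2}_p$ is the Sobolev space of functions $u(t,x)$ on $\mathbb{R}^2$ such that $u,u_x,u_{xx},u_t\in L_p(\mathbb{R}^2)$, and $\overset{0}{W}{}^{1,2}_p(Q)$ is the set of restrictions to $Q$ of functions in $W^{1,2}_p$ that are identically zero for $t\le0$. *)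

(* Defs.v *)
From mathcomp Require Export all_boot all_order all_algebra.
From mathcomp Require Export all_classical all_reals all_analysis.

Set Implicit Arguments.
Unset Strict Implicit.
Unset Printing Implicit Defensive.

Import Order.TTheory GRing.Theory Num.Theory.
Import numFieldNormedType.Exports.

Local Open Scope classical_set_scope.
Local Open Scope ring_scope.

(* Points of the plane are pairs z = (t, x).  A function on
   an open set O is represented by a total function R * R -> R whose values
   outside O are irrelevant. *)

(* R * R with the product of the Borel sigma-algebras on which
   lebesgue_measure is defined. *)
Notation borel_plane R := (measurableTypeR R * measurableTypeR R)%type.

Notation plane_measure R :=
  (@lebesgue_measure R \x @lebesgue_measure R)%E.

Definition Q (R : realType) : set (R * R) :=
  [set z : R * R | 0 < z.1 < 1].

Definition e_t (R : realType) : R * R := (1, 0).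
Definition e_x (R : realType) : R * R := (0, 1).

(* Iterated classical directional derivative, D_{v1} (D_{v2} (... phi)) for
   s = [:: v1; v2; ...]. *)
Definition iter_deriv (R : realType) (s : seq (R * R)) (phi : R * R -> R) :
    R * R -> R :=
  foldr (fun v (g : R * R -> R) => 'D_v g) phi s.

(* C^oo(R^2): every iterated directional derivative is Frechet differentiable
   everywhere. *)
Definition smooth (R : realType) (phi : R * R -> R) : Prop :=
  forall (s : seq (R * R)) (z : R * R), differentiable (iter_deriv s phi) z.

Definition test_function (R : realType) (O : set (R * R)) (phi : R * R -> R) :
    Prop :=
  [/\ smooth phi,
      compact (closure [set z | phi z != 0]) &
      closure [set z | phi z != 0] `<=` O].

Definition loc_integrable (R : realType) (O : set (R * R)) (u : R * R -> R) :
    Prop :=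
  measurable_fun (O : set (borel_plane R)) u /\
  forall K : set (R * R), compact K -> K `<=` O ->
    (plane_measure R).-integrable K (EFin \o u).

(* w is a version on the open set O of the generalized (Sobolev) derivative
   D_{v1} ... D_{vk} u, for s = [:: v1; ...; vk]; such a w is unique up to
   equality almost everywhere on O. *)
Definition is_weak_deriv (R : realType) (O : set (R * R)) (s : seq (R * R))
    (u w : R * R -> R) : Prop :=
  [/\ loc_integrable O u, loc_integrable O w &
      forall phi : R * R -> R, test_function O phi ->
        \int[plane_measure R]_(z in O) (u z * iter_deriv s phi z) =
        (-1) ^+ size s * \int[plane_measure R]_(z in O) (w z * phi z)].

Definition is_dt (R : realType) (O : set (R * R)) : (R * R -> R) ->
  (R * R -> R) -> Prop := is_weak_deriv O [:: e_t R].
Definition is_dx (R : realType) (O : set (R * R)) : (R * R -> R) ->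
  (R * R -> R) -> Prop := is_weak_deriv O [:: e_x R].
Definition is_dxx (R : realType) (O : set (R * R)) : (R * R -> R) ->
  (R * R -> R) -> Prop := is_weak_deriv O [:: e_x R; e_x R].

Definition W12 (R : realType) (p : R) : set (R * R -> R) :=
  [set u | exists ut ux uxx : R * R -> R,
    [/\ is_dt setT u ut, is_dx setT u ux & is_dxx setT u uxx] /\
    [/\ u \in Lfun (plane_measure R) p%:E,
        ux \in Lfun (plane_measure R) p%:E,
        uxx \in Lfun (plane_measure R) p%:E &
        ut \in Lfun (plane_measure R) p%:E]].

Definition W12_0 (R : realType) (p : R) : set (R * R -> R) :=
  [set u | exists U : R * R -> R,
    [/\ W12 p U,
        (forall z : R * R, z.1 <= 0 -> U z = 0) &
        (forall z : R * R, Q z -> u z = U z)]].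

Definition coef_class (R : realType) (beta alpha : R) : set (R * R -> R) :=
  [set a | measurable_fun (@Q R : set (borel_plane R)) a /\
           forall z : R * R, Q z -> beta <= a z <= alpha].

Definition LpQ_norm (R : realType) (p : R) (f : R * R -> R) : \bar R :=
  ('N[plane_measure R]_(p%:E)[EFin \o (f \_ (@Q R))])%E.

(* Main.v *)
Require Import Defs.
From mathcomp Require Import measurable_realfun ring lra.
Set Implicit Arguments.
Unset Strict Implicit.
Unset Printing Implicit Defensive.
Import Order.TTheory GRing.Theory Num.Theory.
Import numFieldNormedType.Exports.
Local Open Scope classical_set_scope.
Local Open Scope ring_scope.

(** For a suitable single coefficient a the estimate already fails at lambda = 1,
    that is, for the operator u_t - a u_xx itself. All functions u constructed
    have continuous derivatives u_t, u_x, u_xx on the whole plane. Fubini and the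
    fundamental theorem of calculus identify these with the generalized
    derivatives (weak_deriv1, weak_deriv2), so that the question is one of
    explicit functions. By parabolic scaling a region of size e in time has
    measure of order e^(3/2); both critical exponents come from this number.

    For p < 3/2, a solution spreads slowly. Given a small k > 0 there are a
    profile H of class C^2 and a coefficient a with 1 <= a <= 9 / (4 k^2) such
    that u = t^(-k) H(x^2 / (9 t)) solves u_t = a u_xx exactly (prof_ode,
    selfsim_eq); the profile is polynomial for x^2 <= 9 t, of Gaussian decay
    outside, and arranged so that u_t and u_xx change sign together. For
    constant a the conservation of mass forces k = 1/2; a large ratio of
    ellipticity allows every small k > 0. Switching
    u on during e < t < 2 e produces the right-hand side u times the derivative
    of the switch, of size e^(-1-k) on a region of measure e^(3/2), hence of
    L_p norm e^(3/(2p) - 1 - k), which tends to 0 if k < 3/(2p) - 1. At times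
    of order 1 the function u_xx does not depend on e (spread_sol_rhs,
    spread_sol_xx_lower).

    For p > 3, a solution focuses at a point. With backward time s and
    y = x - c, the function (s + y^2/4)^g - K s (b s + y^2/4)^(g-1), where
    1/2 < g < 1, has, for suitable b and K, a positive second derivative in y and
    a negative derivative in s, both comparable to (s + y^2/4)^(g-1)
    (focus_bounds). The quotient is therefore an admissible coefficient for
    which u(t, x) = v(1 + e - t, x - c) solves the equation, where v is that
    function. The function v and its derivative v_y are bounded, so that
    multiplication by cutoffs leaves a right-hand side bounded uniformly in e
    (focus_sol_rhs), but u_xx is of size e^(g-1) on a region of measure e^(3/2)
    (focus_sol_xx_lower) and its L_p norm is unbounded as e tends to 0 if
    g < 1 - 3/(2p). This coefficient depends on e; the coefficients for a
    sequence of values e tending to 0 are placed side by side in disjoint cells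
    of the strip (gluedcoef_class). *)

(** * Real powers *)

Section powers.
Variable R : realType.
Implicit Types a s v w : R.

Lemma powR_subr1 (v a : R) : 0 < v -> v `^ (a - 1) = v `^ a / v.
Proof.
by move=> v0; rewrite powRB; [rewrite powRr1// ltW|rewrite (gt_eqF v0) implybT].
Qed.

Lemma powR_deriv (s a : R) : 0 < s ->
  is_derive s 1 (fun s => s `^ a) (a * (s `^ a / s)).
Proof.
move=> s0; have := is_derive1_powR a s0.
by rewrite powR_subr1.
Qed.

Lemma powR_anti a v w : a <= 0 -> 0 < v -> v <= w -> w `^ a <= v `^ a.
Proof.
move=> a0 v0 vw; have w0 : 0 < w by rewrite (lt_le_trans v0).
have b0 : 0 <= - a by rewrite oppr_ge0.
rewrite -[a]opprK; move: (- a) b0 => b b0.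
rewrite !powRN lef_pV2 ?posrE ?powR_gt0//; apply: ge0_ler_powR => //.
- by rewrite nnegrE ltW.
- by rewrite nnegrE ltW.
Qed.

(** Used to pick the scale e at which a positive power of e absorbs all the
    constants of a construction; the bound 1/8 keeps the switching interval
    (e, 2 e) away from t = 1/2. *)
Lemma small_powR (eta B d : R) : 0 < eta -> 0 <= B -> 0 < d ->
  exists2 e : R, 0 < e <= 8^-1 & B * e `^ eta < d.
Proof.
move=> eta0 B0 d0.
have r0 : 0 < d / (B + 1) by rewrite divr_gt0// ltr_wpDl.
pose e := Num.min 8^-1 ((d / (B + 1)) `^ eta^-1).
have e0 : 0 < e by rewrite lt_min invr_gt0 ltr0n powR_gt0.
exists e; first by rewrite e0 ge_min lexx.
have : e `^ eta <= d / (B + 1).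
  apply: (@le_trans _ _ (((d / (B + 1)) `^ eta^-1) `^ eta)).
    apply: ge0_ler_powR; rewrite ?nnegrE ?powR_ge0// ?(ltW e0)// ?(ltW eta0)//.
    by rewrite ge_min lexx orbT.
  by rewrite -powRrM mulVf ?gt_eqF// powRr1// ltW.
move=> /(ler_wpM2l B0) /le_lt_trans; apply.
by rewrite mulrCA gtr_pMr// ltr_pdivrMr ?mul1r ?ltrDl// ltr_wpDl.
Qed.

End powers.

(** * Measurability and integration on the plane *)

(** The sigma-algebra on the plane is the product one, so openness has to be
    converted into measurability: an open set is the countable union of the
    rational open boxes that it contains. *)
Lemma open_plane_measurable (R : realType) (A : set (R * R)) :
  open A -> measurable (A : set (borel_plane R)).
Proof.
move=> oA.
pose box (q : (rat * rat) * (rat * rat)) : set (borel_plane R) :=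
  `]ratr q.1.1, ratr q.1.2[%classic `*` `]ratr q.2.1, ratr q.2.2[%classic.
have -> : (A : set (borel_plane R)) =
    \bigcup_q (if `[< box q `<=` A >] then box q else set0).
  apply/seteqP; split => [[t x] Atx|[t x] [q _]]; last first.
    by case: asboolP => // qA /qA.
  have := oA; rewrite openE => /(_ _ Atx) [[B C] [/= nB nC] BC].
  have rat_itv (r : R) (D : set R) : nbhs r D ->
      exists q1 q2 : rat, `]ratr q1, ratr q2[%classic r /\
        `]ratr q1, ratr q2[%classic `<=` D.
    case=> e /= e0 eD.
    have /rat_in_itvoo[q1] : r - e < r by rewrite ltrBlDr ltrDl.
    have /rat_in_itvoo[q2] : r < r + e by rewrite ltrDl.
    rewrite !in_itv/= => /andP[rq2 q2e] /andP[eq1 q1r].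
    exists q1, q2; split; first by rewrite /= in_itv/= q1r.
    move=> y /=; rewrite in_itv/= => /andP[q1y yq2]; apply: eD => /=.
    by rewrite ltr_distlC (lt_trans eq1)// (lt_trans yq2).
  have [q1 [q2 [tq qB]]] := rat_itv _ _ nB.
  have [q3 [q4 [xq qC]]] := rat_itv _ _ nC.
  exists ((q1, q2), (q3, q4)) => //; case: asboolP => [_ //|].
  by case=> -[t' x'] [/= /qB Bt' /qC Cx']; exact: BC.
apply: countable_bigcupT_measurable => // q; case: ifP => _ //.
exact: measurableX.
Qed.

Lemma closed_plane_measurable (R : realType) (A : set (R * R)) :
  closed A -> measurable (A : set (borel_plane R)).
Proof.
by move/closed_openC/open_plane_measurable/measurableC; rewrite setCK.
Qed.

Lemma continuous_plane_measurable (R : realType) (f : R * R -> R) :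
  continuous f -> measurable_fun (setT : set (borel_plane R)) f.
Proof.
move=> /continuousP cf; apply: (measurability _ (RGenOpens.measurableE R)).
move=> _ [_ [a [b ->] <-]]; rewrite setTI; apply: open_plane_measurable.
exact/cf/interval_open.
Qed.

(** The coefficients constructed below involve quotients that are continuous only
    where their denominators do not vanish. *)
Lemma open_continuous_plane_measurable (R : realType) (D : set (R * R))
    (f : R * R -> R) :
  open D -> {in D, continuous f} -> measurable_fun (D : set (borel_plane R)) f.
Proof.
move=> oD cf.
have cf' : forall A, open A -> open (D `&` f @^-1` A).
  move=> A oA; rewrite openE => z [Dz Az].
  apply: filterI; first exact: open_nbhs_nbhs.
  apply: (cf z); first by rewrite inE.
  exact: open_nbhs_nbhs.
apply: (measurability _ (RGenOpens.measurableE R)).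
move=> _ [_ [a [b ->] <-]]; apply: open_plane_measurable.
exact/cf'/interval_open.
Qed.

Section plane_calculus.
Variable R : realType.
Notation mu2 := (plane_measure R).
Notation mu := (@lebesgue_measure R).
Implicit Types (f g w : R * R -> R).

Lemma lebesgue_segment (x y : R) : x <= y -> mu `[x, y]%classic = (y - x)%:E.
Proof.
rewrite lebesgue_measure_itv/= lte_fin le_eqVlt => /predU1P[->|->].
  by rewrite ltxx subrr.
by rewrite EFinB.
Qed.

Lemma plane_box (a b c d : R) : a <= b -> c <= d ->
  mu2 (`[a, b]%classic `*` `[c, d]%classic) = ((b - a) * (d - c))%:E.
Proof.
by move=> ab cd; rewrite product_measure1E//= !lebesgue_segment// -EFinM.
Qed.

Lemma compact_plane_box (K : set (R * R)) : compact K ->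
  exists2 M : R, 0 < M &
    K `<=` `[- M, M]%classic `*` `[- M, M]%classic.
Proof.
move=> /compact_bounded [M [Mr MK]].
have M1 : M < Num.max 1 (M + 1) by rewrite lt_max ltrDl ltr01 orbT.
exists (Num.max 1 (M + 1)); first by rewrite lt_max ltr01.
move=> [t x] /(MK _ M1) /=; rewrite !in_itv /=.
by rewrite prod_normE ge_max !ler_norml => /andP[? ?]; split.
Qed.

Lemma plane_funTS (O : set (R * R)) f :
  measurable_fun (setT : set (borel_plane R)) f ->
  measurable_fun (O : set (borel_plane R)) f.
Proof.
move=> mf.
by apply: (@measurable_funTS _ _ (borel_plane R)); exact: mf.
Qed.

(** A continuous function is bounded on a compact set, and a compact set of the
    plane lies in a box of finite measure. *)
Lemma continuous_loc_integrable (O : set (R * R)) f :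
  measurable (O : set (borel_plane R)) -> continuous f -> loc_integrable O f.
Proof.
move=> mO cf; split.
  by apply: plane_funTS; exact: continuous_plane_measurable.
move=> K cK KO.
have mK : measurable (K : set (borel_plane R)).
  apply: closed_plane_measurable; apply: compact_closed cK.
  exact: norm_hausdorff.
apply: measurable_bounded_integrable => //.
- have [M M0 KM] := compact_plane_box cK.
  apply: (@le_lt_trans _ _ (mu2 (`[- M, M]%classic `*` `[- M, M]%classic
      : set (borel_plane R)))).
    by apply: le_measure => //; rewrite inE//; exact: measurableX.
  by rewrite plane_box ?ltry// lerNl (le_trans _ (ltW M0))// oppr_le0 ltW.
- by apply: plane_funTS; exact: continuous_plane_measurable.
- have := @continuous_compact _ _ f K _ cK => /(_ (continuous_subspaceT cf)).
  move=> /compact_bounded [M [Mr MK]]; exists M; split => // x Mx z Kz.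
  by apply: MK => //; exists z.
Qed.

Lemma slice_t_continuous f (x : R) :
  continuous f -> continuous (fun t : R => f (t, x)).
Proof.
move=> cf t; apply: (@continuous_comp _ _ _ (fun s : R => (s, x)) f).
  apply: (@cvg_pair _ _ _ (nbhs t) (nbhs t) (nbhs x) _ _ _ id (cst x) _ _).
    exact: cvg_id.
  exact: cvg_cst.
exact: cf.
Qed.

Lemma slice_x_continuous f (t : R) :
  continuous f -> continuous (fun x : R => f (t, x)).
Proof.
move=> cf x; apply: (@continuous_comp _ _ _ (fun s : R => (t, s)) f).
  apply: (@cvg_pair _ _ _ (nbhs x) (nbhs t) (nbhs x) _ _ _ (cst t) id _ _).
    exact: cvg_cst.
  exact: cvg_id.
exact: cf.
Qed.

(** A directional derivative along an axis only sees the restriction of the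
    function to that line, and the difference quotients are literally the same. *)
Lemma slice_t_deriv f (t x d : R) :
  is_derive (t, x) (e_t R) f d <-> is_derive (t : R) 1 (fun s => f (s, x)) d.
Proof.
have E : (fun h : R => h^-1 *: ((f \o shift (t, x)) (h *: e_t R) - f (t, x)))
  = (fun h : R => h^-1 *: (((fun s => f (s, x)) \o shift t) (h *: (1 : R)) - f (t, x))).
  by apply/funext => h /=; congr (_ *: (f _ - _)); congr pair => /=;
    rewrite scaler0 add0r.
by split => -[]; [rewrite /derivable /derive E|rewrite /derivable /derive -E];
  move=> dv dE; constructor.
Qed.

Lemma slice_x_deriv f (t x d : R) :
  is_derive (t, x) (e_x R) f d <-> is_derive (x : R) 1 (fun s => f (t, s)) d.
Proof.
have E : (fun h : R => h^-1 *: ((f \o shift (t, x)) (h *: e_x R) - f (t, x)))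
  = (fun h : R => h^-1 *: (((fun s => f (t, s)) \o shift x) (h *: (1 : R)) - f (t, x))).
  by apply/funext => h /=; congr (_ *: (f _ - _)); congr pair => /=;
    rewrite scaler0 add0r.
by split => -[]; [rewrite /derivable /derive E|rewrite /derivable /derive -E];
  move=> dv dE; constructor.
Qed.

(** Every compact set lies in such a square, so integrals over the plane of
    compactly supported functions are iterated integrals over a segment. *)
Definition plane_square (M : R) : set (borel_plane R) :=
  `[- M, M]%classic `*` `[- M, M]%classic.

Lemma plane_square_compact M : compact (plane_square M : set (R * R)).
Proof. by apply: compact_setX; exact: segment_compact. Qed.

Lemma plane_square_measurable M : measurable (plane_square M).
Proof. exact: measurableX. Qed.

Lemma box_integrable f M : continuous f ->
  (forall z, ~ plane_square M z -> f z = 0) -> mu2.-integrable setT (EFin \o f).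
Proof.
move=> cf f0.
have -> : EFin \o f = (EFin \o f) \_ (plane_square M).
  apply/funext => z; rewrite /patch; case: ifPn => // /negP zM.
  by rewrite /= f0// => zM'; apply: zM; rewrite inE.
apply/(integrable_mkcond _ _).1; first exact: plane_square_measurable.
have [_] := @continuous_loc_integrable setT f measurableT cf.
by apply => //; exact: plane_square_compact.
Qed.

Lemma FTC_zero (F dF : R -> R) (M : R) : continuous dF ->
  (forall t : R, is_derive t 1 F (dF t)) ->
  (forall t : R, ~ (- M <= t <= M) -> F t = 0 /\ dF t = 0) ->
  (\int[mu]_t (dF t)%:E = 0)%E.
Proof.
move=> cdF FdF F0.
pose L : R := `|M| + 1.
have L0 : 0 < L by rewrite ltr_wpDl.
have L1 : - L < L by rewrite (@lt_trans _ _ 0)// oppr_lt0.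
have Mout t : L <= `|t| -> ~ (- M <= t <= M).
  move=> Mt; rewrite -ler_norml => /(le_trans Mt) /le_trans/(_ (ler_norm M)).
  by rewrite gerDl ler10.
have -> : (\int[mu]_t (dF t)%:E = \int[mu]_(t in `[(- L)%R, L]) (dF t)%:E)%E.
  rewrite [RHS]integral_mkcond; apply: eq_integral => t _.
  rewrite /patch; case: ifPn => // /negP tM.
  rewrite (F0 t _).2//; apply: Mout; rewrite leNgt; apply/negP => tM'.
  apply: tM; rewrite inE/= in_itv/=; move: tM'.
  by rewrite ltr_norml => /andP[/ltW -> /ltW ->].
rewrite (@continuous_FTC2 _ dF F)//.
- rewrite (F0 L _).1 ?(F0 (- L) _).1 ?subee//;
    by apply: Mout; rewrite ?normrN ger0_norm// ltW.
- exact: continuous_subspaceT.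
- have cF : continuous F.
    move=> t; apply: differentiable_continuous; apply/derivable1_diffP.
    by case: (FdF t).
  split.
  + by move=> t _; case: (FdF t).
  + exact/cvg_at_right_filter/cF.
  + exact/cvg_at_left_filter/cF.
- by move=> t _; rewrite derive1E; exact: derive_val.
Qed.

(** Fubini reduces the claim to lines parallel to the axis v, on which the
    fundamental theorem of calculus gives the difference of two zero values. *)
Lemma integral_partial_eq0 (v : R * R) w dw M : v = e_t R \/ v = e_x R ->
  continuous dw -> (forall z, is_derive z v w (dw z)) ->
  (forall z, ~ plane_square M z -> w z = 0 /\ dw z = 0) ->
  \int[mu2]_z dw z = 0.
Proof.
move=> vE cdw wdw w0; rewrite /Rintegral.
have idw : mu2.-integrable setT (EFin \o dw).
  by apply: (@box_integrable _ M) => // z /w0[].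
suff -> : (\int[mu2]_z (dw z)%:E = 0)%E by [].
have slt t x : ~ (- M <= t <= M) -> ~ plane_square M (t, x).
  by move=> tM [/=]; rewrite in_itv.
have slx t x : ~ (- M <= x <= M) -> ~ plane_square M (t, x).
  by move=> xM [/=]; rewrite !in_itv.
case: vE => vE; rewrite vE in wdw.
- rewrite -(integral21_prod_meas1 idw); apply: integral0_eq => x _.
  rewrite /fubini_G /=; apply: (@FTC_zero (fun t => w (t, x)) _ M).
  + exact: slice_t_continuous.
  + by move=> t; apply/slice_t_deriv.
  + by move=> t /slt /w0.
- rewrite -(integral12_prod_meas1 idw); apply: integral0_eq => t _.
  rewrite /fubini_F /=; apply: (@FTC_zero (fun x => w (t, x)) _ M).
  + exact: slice_x_continuous.
  + by move=> x; apply/slice_x_deriv.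
  + by move=> x /slx /w0.
Qed.

(** * Weak derivatives of classically differentiable functions *)

Lemma derive_off_support (phi : R * R -> R) (v z : R * R) (S : set (R * R)) :
  closed S -> (forall z, ~ S z -> phi z = 0) -> ~ S z -> 'D_v phi z = 0.
Proof.
move=> cS phi0 Sz; rewrite -(@derive_cst _ _ _ 0 z v).
apply: near_eq_derive.
have : open (~` S) by exact: closed_openC.
rewrite openE => /(_ z Sz); apply: filterS => y Sy /=.
exact: phi0.
Qed.

Lemma iter_deriv_off_support (s : seq (R * R)) (phi : R * R -> R)
    (S : set (R * R)) :
  closed S -> (forall z, ~ S z -> phi z = 0) ->
  forall z, ~ S z -> iter_deriv s phi z = 0.
Proof.
move=> cS phi0; elim: s => [//|v s IH] z Sz /=.
exact: (derive_off_support v cS).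
Qed.

(** Continuity of both functions makes all integrands continuous, so that
    integrability on compact sets comes for free. *)
Definition has_partial (v : R * R) (f df : R * R -> R) :=
  [/\ continuous f, continuous df & forall z, is_derive z v f (df z)].

Lemma Rintegral_on (O : set (R * R)) f :
  (forall z, ~ O z -> f z = 0) -> \int[mu2]_(z in O) f z = \int[mu2]_z f z.
Proof.
move=> f0; rewrite Rintegral_mkcond; congr (Rintegral _ _ _).
apply/funext => z; rewrite /patch; case: ifPn => // /negP zO.
by rewrite f0// => Oz; apply: zO; rewrite inE.
Qed.

(** The product rule turns the sum of the two integrands into the derivative of
    u psi, which has compact support, hence integral zero. *)
Lemma integral_partial_by_parts (v : R * R) (u du psi dpsi : R * R -> R)
    (S : set (R * R)) :
  v = e_t R \/ v = e_x R -> compact S ->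
  has_partial v u du -> has_partial v psi dpsi ->
  (forall z, ~ S z -> psi z = 0 /\ dpsi z = 0) ->
  \int[mu2]_z (u z * dpsi z) = - \int[mu2]_z (du z * psi z).
Proof.
move=> vE cS [cu cdu Du] [cpsi cdpsi Dpsi] psi0.
have [M M0 SM] := compact_plane_box cS.
have out z : ~ plane_square M z -> psi z = 0 /\ dpsi z = 0.
  by move=> zM; apply: psi0 => Sz; apply: zM; exact: SM.
have c1 : continuous (fun z => u z * dpsi z).
  by move=> z; apply: continuousM; [exact: cu|exact: cdpsi].
have c2 : continuous (fun z => du z * psi z).
  by move=> z; apply: continuousM; [exact: cdu|exact: cpsi].
have c3 : continuous (fun z => u z * dpsi z + du z * psi z).
  by move=> z; apply: cvgD; [exact: c1|exact: c2].
have i1 : mu2.-integrable setT (EFin \o (fun z => u z * dpsi z)).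
  by apply: (@box_integrable _ M) => // z /out[_ ->]; rewrite mulr0.
have i2 : mu2.-integrable setT (EFin \o (fun z => du z * psi z)).
  by apply: (@box_integrable _ M) => // z /out[-> _]; rewrite mulr0.
apply/eqP; rewrite -subr_eq0 opprK -RintegralD//; apply/eqP.
apply: (@integral_partial_eq0 v (u * psi) _ M) => //.
- move=> z; have Hu := Du z; have Hp := Dpsi z.
  apply: is_derive_eq; rewrite /= /GRing.scale/= [psi z * _]mulrC.
  done.
- move=> z /out[p0 dp0]; rewrite p0 dp0 !mulr0 addr0; split=> //.
  by rewrite /GRing.mul/= p0 mulr0.
Qed.

Lemma smooth_has_partial (phi : R * R -> R) (v : R * R) (s : seq (R * R)) :
  smooth phi -> has_partial v (iter_deriv s phi) (iter_deriv (v :: s) phi).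
Proof.
move=> sphi; split.
- by move=> z; apply: differentiable_continuous; exact: sphi.
- by move=> z; apply: differentiable_continuous; exact: sphi.
- by move=> z; apply: derivableP; apply: diff_derivable; exact: sphi.
Qed.

(** On an open set O a test function vanishes off O together with its
    derivatives, so that integrals over O are integrals over the plane and the
    integration by parts needs no boundary term. *)
Lemma weak_deriv1 (O : set (R * R)) (v : R * R) (u du : R * R -> R) :
  v = e_t R \/ v = e_x R -> measurable (O : set (borel_plane R)) ->
  has_partial v u du -> is_weak_deriv O [:: v] u du.
Proof.
move=> vE mO [cu cdu Du]; split.
- exact: continuous_loc_integrable.
- exact: continuous_loc_integrable.
move=> phi [sphi cphi phiO].
set S := closure _ in cphi phiO.
have phi0 z : ~ S z -> phi z = 0.
  by move=> Sz; apply: contrapT => /eqP pz; apply: Sz; exact: subset_closure.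
have clS : closed S by exact: closed_closure.
have out s z : ~ O z -> iter_deriv s phi z = 0.
  by move=> Oz; apply: (iter_deriv_off_support s clS phi0) => /phiO.
rewrite (Rintegral_on (f := fun z => u z * _)); last first.
  by move=> z Oz; rewrite out ?mulr0.
rewrite (Rintegral_on (f := fun z => du z * _)); last first.
  by move=> z Oz; rewrite (out [::] z Oz : phi z = 0) mulr0.
rewrite expr1 mulN1r; apply: (integral_partial_by_parts vE cphi) => //.
- exact: (@smooth_has_partial phi v [::]).
- by move=> z Sz; rewrite phi0//; split=> //; exact: (derive_off_support v clS).
Qed.

(** Two integrations by parts; the two signs cancel. *)
Lemma weak_deriv2 (O : set (R * R)) (v : R * R) (u du ddu : R * R -> R) :
  v = e_t R \/ v = e_x R -> measurable (O : set (borel_plane R)) ->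
  has_partial v u du -> has_partial v du ddu ->
  is_weak_deriv O [:: v; v] u ddu.
Proof.
move=> vE mO Hu Hdu; split.
- by case: Hu => cu _ _; exact: continuous_loc_integrable.
- by case: Hdu => _ cdu _; exact: continuous_loc_integrable.
move=> phi [sphi cphi phiO].
set S := closure _ in cphi phiO.
have phi0 z : ~ S z -> phi z = 0.
  by move=> Sz; apply: contrapT => /eqP pz; apply: Sz; exact: subset_closure.
have clS : closed S by exact: closed_closure.
have out s z : ~ O z -> iter_deriv s phi z = 0.
  by move=> Oz; apply: (iter_deriv_off_support s clS phi0) => /phiO.
rewrite (Rintegral_on (f := fun z => u z * _)); last first.
  by move=> z Oz; rewrite out ?mulr0.
rewrite (Rintegral_on (f := fun z => ddu z * _)); last first.
  by move=> z Oz; rewrite (out [::] z Oz : phi z = 0) mulr0.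
rewrite (integral_partial_by_parts vE cphi Hu
  (smooth_has_partial v [:: v] sphi)); last first.
  by move=> z Sz; split; exact: (iter_deriv_off_support _ clS phi0).
rewrite (integral_partial_by_parts vE cphi Hdu
  (smooth_has_partial v [::] sphi)); last first.
  by move=> z Sz; split; exact: (iter_deriv_off_support _ clS phi0).
by rewrite opprK sqrrN expr1n mul1r.
Qed.

(** * Bounds for L_p norms on the plane *)

Lemma measurable_norm_powR f (p : R) :
  measurable_fun (setT : set (borel_plane R)) f ->
  measurable_fun (setT : set (borel_plane R)) (EFin \o (fun z => `|f z| `^ p)).
Proof.
move=> mf; apply/measurable_EFinP.
apply: (measurableT_comp (measurable_powR p)) => //.
exact: measurableT_comp.
Qed.

Lemma Lnorm_plane_E f (p : R) :
  'N[mu2]_(p%:E)[EFin \o f]%E =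
  ((\int[mu2]_z (`|f z| `^ p)%:E) `^ p^-1)%E.
Proof. by rewrite unlock. Qed.

(** Since w takes its values in [0, 1] and p >= 1, the p-th power of the
    product weight is at most the weight itself: only the integral of w, and not
    that of w^p, has to be known. This is why the same weights serve all exponents. *)
Lemma Lnorm_plane_le f (w : R -> R) (p C T W : R) :
  1 <= p -> 0 <= C -> 0 <= T -> 0 <= W ->
  measurable_fun (setT : set (borel_plane R)) f ->
  measurable_fun (setT : set (measurableTypeR R)) w -> (forall x, 0 <= w x <= 1) ->
  (\int[mu]_x (w x)%:E = W%:E)%E ->
  (forall t x, `|f (t, x)| <= C * (\1_(`[0, T]%classic) t * w x)) ->
  ('N[mu2]_(p%:E)[EFin \o f] <= (C * (T * W) `^ p^-1)%:E)%E.
Proof.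
move=> p1 C0 T0 W0 mf mw w01 wW fC; rewrite Lnorm_plane_E.
have p0 : 0 < p by rewrite (lt_le_trans _ p1).
pose g (z : borel_plane R) := (C `^ p * (\1_(`[0, T]%classic) z.1 * w z.2))%:E.
have mg : measurable_fun setT g.
  apply/measurable_EFinP; apply: measurable_funM => //.
  apply: measurable_funM; last exact: measurableT_comp.
  by apply: measurableT_comp => //; exact: measurable_indic.
have ind0 t : 0 <= \1_(`[0, T]%classic) t :> R.
  by rewrite indicE; case: (_ \in _).
have ind1 t : \1_(`[0, T]%classic) t <= 1 :> R.
  by rewrite indicE; case: (_ \in _).
have g0 z : (0 <= g z)%E.
  have /andP[w0 _] := w01 z.2.
  by rewrite lee_fin !mulr_ge0// powR_ge0.
have fg z : ((`|f z| `^ p)%:E <= g z)%E.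
  have /andP[w0 w1] := w01 z.2.
  rewrite lee_fin; apply: (@le_trans _ _ ((C * (\1_(`[0, T]%classic) z.1 * w z.2)) `^ p)).
    apply: ge0_ler_powR; [exact: ltW|by rewrite nnegrE|
      by rewrite nnegrE !mulr_ge0|].
    by case: z {w0 w1} => t x; exact: fC.
  rewrite powRM ?mulr_ge0//; apply: ler_wpM2l; first exact: powR_ge0.
  set r := _ * _; have r0 : 0 <= r by rewrite mulr_ge0.
  have r1 : r <= 1 by rewrite -[1]mulr1; exact: ler_pM.
  have [->|rN0] := eqVneq r 0; first by rewrite powR0// gt_eqF.
  by apply: ge1r_powR => //; rewrite r1 andbT lt_neqAle eq_sym rN0 r0.
have gE : (\int[mu2]_z g z = (C `^ p * (T * W))%:E)%E.
  rewrite (fubini_tonelli1 g)//.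
  under eq_integral => t _.
    rewrite /fubini_F /g/=.
    under eq_integral do rewrite mulrA EFinM.
    rewrite ge0_integralZl_EFin//; last 3 first.
    - by move=> x _; have /andP[w0 _] := w01 x; rewrite lee_fin.
    - exact/measurable_EFinP.
    - by rewrite mulr_ge0// powR_ge0.
    rewrite wW -EFinM -mulrA [_ * W]mulrC mulrA EFinM.
    over.
  rewrite ge0_integralZl_EFin//; last 2 first.
  - by apply/measurable_EFinP; exact: measurable_indic.
  - by rewrite mulr_ge0// powR_ge0.
  have -> : (\int[mu]_t (\1_(`[0, T]%classic) t)%:E = T%:E)%E.
    by rewrite integral_indic// setIT; have := lebesgue_segment T0; rewrite subr0.
  by rewrite -EFinM mulrAC -mulrA.
have : (\int[mu2]_z (`|f z| `^ p)%:E <= (C `^ p * (T * W))%:E)%E.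
  rewrite -gE; apply: ge0_le_integral => //.
  exact: measurable_norm_powR.
move=> fle; apply: (@le_trans _ _ (((C `^ p * (T * W))%:E) `^ p^-1)%E).
  apply: gt0_ler_poweR => //.
  - by rewrite invr_ge0 ltW.
  - by rewrite in_itv/= leey andbT; apply: integral_ge0 => z _; rewrite lee_fin powR_ge0.
  - by rewrite in_itv/= leey andbT lee_fin !mulr_ge0// powR_ge0.
rewrite poweR_EFin lee_fin powRM ?powR_ge0 ?mulr_ge0//.
by rewrite -powRrM divff ?gt_eqF// powRr1.
Qed.

(** Restricting the integral to a box on which the function is at least m. *)
Lemma Lnorm_plane_ge f (p m a b c d : R) :
  0 < p -> 0 <= m -> a <= b -> c <= d ->
  measurable_fun (setT : set (borel_plane R)) f ->
  (forall t x, a <= t <= b -> c <= x <= d -> m <= `|f (t, x)|) ->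
  ((m * ((b - a) * (d - c)) `^ p^-1)%:E <= 'N[mu2]_(p%:E)[EFin \o f])%E.
Proof.
move=> p0 m0 ab cd mf fm; rewrite Lnorm_plane_E.
pose B : set (borel_plane R) := `[a, b]%classic `*` `[c, d]%classic.
have mB : measurable B by exact: measurableX.
have mint : ((m `^ p * ((b - a) * (d - c)))%:E <=
    \int[mu2]_z (`|f z| `^ p)%:E)%E.
  apply: (@le_trans _ _ (\int[mu2]_(z in B) (`|f z| `^ p)%:E)%E); last first.
    apply: ge0_subset_integral => //.
    exact: measurable_norm_powR.
  rewrite EFinM -(plane_box ab cd) -(integral_cst _ mB).
  apply: ge0_le_integral => //.
  - by move=> z _; rewrite lee_fin powR_ge0.
  - apply: (@measurable_funTS _ _ (borel_plane R)).
    exact: measurable_norm_powR.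
  - move=> [t x] [/= tab xcd]; rewrite lee_fin; apply: ge0_ler_powR => //.
    + by rewrite ltW.
    + by apply: fm; [move: tab|move: xcd]; rewrite in_itv.
apply: (@le_trans _ _ (((m `^ p * ((b - a) * (d - c)))%:E) `^ p^-1)%E).
  rewrite poweR_EFin lee_fin [leRHS]powRM ?powR_ge0 ?mulr_ge0 ?subr_ge0//.
  by rewrite -powRrM divff ?gt_eqF// powRr1.
apply: gt0_ler_poweR => //.
- by rewrite invr_ge0 ltW.
- by rewrite in_itv/= leey andbT lee_fin !mulr_ge0 ?powR_ge0 ?subr_ge0.
- by rewrite in_itv/= leey andbT; apply: integral_ge0 => z _; rewrite lee_fin powR_ge0.
Qed.

(** The Cauchy density profile of width s: a decaying weight with values in
    [0, 1] whose primitive, an arctangent, is explicit. *)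
Definition cauchy_weight (s x : R) : R := (1 + (x / s) ^+ 2)^-1.

Lemma cauchy_weight01 (s x : R) : 0 <= cauchy_weight s x <= 1.
Proof.
have h : 1 <= 1 + (x / s) ^+ 2 by rewrite lerDl sqr_ge0.
by rewrite /cauchy_weight invr_ge0 (le_trans _ h)//= invf_le1// (lt_le_trans _ h).
Qed.

Lemma cauchy_weight_continuous (s : R) : continuous (cauchy_weight s).
Proof.
move=> x; apply: (@continuous_comp _ _ _ (fun y : R => y / s) (fun y => (1 + y ^+ 2)^-1)).
  by apply: cvgM; [exact: cvg_id|exact: cvg_cst].
exact: (@continuous_oneDsqrV R).
Qed.

Lemma integral_cauchy_weight (s : R) : 0 < s ->
  (\int[mu]_x (cauchy_weight s x)%:E = (pi * s)%:E)%E.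
Proof.
move=> s0.
rewrite ge0_symfun_integralT; last 3 first.
- by move=> x; have /andP[] := cauchy_weight01 s x.
- exact: cauchy_weight_continuous.
- by move=> x; rewrite /cauchy_weight /= mulNr sqrrN.
pose F (x : R) := s * atan (x / s).
have dF (x : R) : is_derive x 1 F (cauchy_weight s x).
  rewrite /F; apply: is_derive_eq.
  rewrite /cauchy_weight /GRing.scale/= mulr1 mulr0 add0r.
  by rewrite mulrCA mulfV ?gt_eqF// mulr1.
rewrite -set_itvcy (@ge0_continuous_FTC2y _ _ F 0 (s * (pi / 2))).
- rewrite /F mul0r atan0 mulr0 sube0 -EFinM; congr EFin.
  by rewrite mulrCA [2 * _]mulrC divfK ?pnatr_eq0// mulrC.
- by move=> x _; have /andP[] := cauchy_weight01 s x.
- by apply: continuous_subspaceT; exact: cauchy_weight_continuous.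
- apply: cvgMr; apply: (@cvg_comp _ _ _ (fun x : R => x / s) atan _ (+oo%R : set_system R)).
    have s10 : 0 < s^-1 by rewrite invr_gt0.
    exact: (gt0_cvgMly s10 cvg_id).
  exact: cvgy_atan.
- by move=> x _; case: (dF x).
- apply: cvg_at_right_filter; apply: differentiable_continuous.
  by apply/derivable1_diffP; case: (dF 0).
- by move=> x _; rewrite derive1E; exact: derive_val.
Qed.

(** * Functions with continuous derivatives u_t, u_x, u_xx *)

Lemma open_Q : open (@Q R).
Proof.
have -> : @Q R = fst @^-1` `]0, 1[%classic.
  by apply/seteqP; split => -[t x]; rewrite /Q/= in_itv.
by apply: open_comp => [z _|]; [exact: cvg_fst|exact: interval_open].
Qed.

Lemma measurable_Q : measurable (@Q R : set (borel_plane R)).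
Proof. by apply: open_plane_measurable; exact: open_Q. Qed.

(** Classical regularity that makes all generalized derivatives in the
    definition of W^{1,2}_p classical ones. *)
Definition C12 (u ut ux uxx : R * R -> R) :=
  [/\ has_partial (e_t R) u ut, has_partial (e_x R) u ux &
      has_partial (e_x R) ux uxx].

(** A bound that implies membership in L_p for all p >= 1 at once. *)
Definition strip_decay f := exists C T : R, [/\ 0 <= C, 0 <= T &
  forall t x, `|f (t, x)| <= C * (\1_(`[0, T]%classic) t * cauchy_weight 1 x)].

Lemma strip_decay_Lfun f (p : R) : 1 <= p -> continuous f -> strip_decay f ->
  f \in Lfun mu2 p%:E.
Proof.
move=> p1 cf [C [T [C0 T0 fC]]].
have mf := continuous_plane_measurable cf.
apply/andP; split; first by rewrite inE.
rewrite inE/= /finite_norm.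
apply: (@le_lt_trans _ _ (C * (T * (pi * 1)) `^ p^-1)%:E); last exact: ltry.
apply: (Lnorm_plane_le (w := cauchy_weight 1)) => //.
- by rewrite mulr1 pi_ge0.
- by apply: continuous_measurable_fun; exact: cauchy_weight_continuous.
- exact: cauchy_weight01.
- exact: integral_cauchy_weight.
Qed.

(** The function itself is taken as its extension to the plane, which is why the
    constructions below are made on the whole plane and not only on the strip. *)
Lemma W12_0_intro (p : R) (u ut ux uxx : R * R -> R) : 1 <= p ->
  C12 u ut ux uxx -> (forall z, z.1 <= 0 -> u z = 0) ->
  strip_decay u -> strip_decay ut -> strip_decay ux -> strip_decay uxx ->
  W12_0 p u.
Proof.
move=> p1 [Pt Px Pxx] u0 du dut dux duxx; exists u; split => //.
exists ut, ux, uxx; split; split.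
- by apply: weak_deriv1 => //; left.
- by apply: weak_deriv1 => //; right.
- by apply: (weak_deriv2 (du := ux)) => //; right.
- by apply: strip_decay_Lfun => //; case: Pt.
- by apply: strip_decay_Lfun => //; case: Px.
- by apply: strip_decay_Lfun => //; case: Pxx.
- by apply: strip_decay_Lfun => //; case: Pt.
Qed.

Lemma C12_dt_Q (u ut ux uxx : R * R -> R) :
  C12 u ut ux uxx -> is_dt (@Q R) u ut.
Proof.
by case=> Pt _ _; apply: weak_deriv1 => //; [left|exact: measurable_Q].
Qed.

Lemma C12_dxx_Q (u ut ux uxx : R * R -> R) :
  C12 u ut ux uxx -> is_dxx (@Q R) u uxx.
Proof.
case=> _ Px Pxx; apply: (weak_deriv2 (du := ux)) => //; first by right.
exact: measurable_Q.
Qed.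

Lemma C12_measurable_Q (u ut ux uxx : R * R -> R) :
  C12 u ut ux uxx -> measurable_fun (@Q R : set (borel_plane R)) ut /\
    measurable_fun (@Q R : set (borel_plane R)) uxx.
Proof.
case=> [[_ ct _] _ [_ cxx _]].
by split; apply: plane_funTS; exact: continuous_plane_measurable.
Qed.

Lemma measurable_rhs (beta alpha lambda : R) (a ut uxx : R * R -> R) :
  coef_class beta alpha a ->
  measurable_fun (@Q R : set (borel_plane R)) ut ->
  measurable_fun (@Q R : set (borel_plane R)) uxx ->
  measurable_fun (@Q R : set (borel_plane R))
    (fun z => ut z - (lambda * a z + 1 - lambda) * uxx z).
Proof.
move=> [ma _] mt mxx; apply: measurable_funB => //; apply: measurable_funM => //.
apply: measurable_funB; last exact: measurable_cst.
apply: measurable_funD; last exact: measurable_cst.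
by apply: measurable_funM; first exact: measurable_cst.
Qed.

(** The failure of the estimate for one fixed coefficient a, the property shared
    by the two constructions. *)
Definition estimate_fails (p : R) (a : R * R -> R) : Prop :=
  forall N : R, 0 < N ->
    exists (u ut uxx : R * R -> R) (lambda : R),
      [/\ W12_0 p u, 0 <= lambda <= 1, is_dt (@Q R) u ut,
          is_dxx (@Q R) u uxx &
          ~ (LpQ_norm p uxx <=
             N%:E * LpQ_norm p (fun z =>
               ut z - (lambda * a z + 1 - lambda) * uxx z)%R)%E].

(** The form in which the estimate is refuted: an upper bound for the right-hand
    side f from a product weight on a time interval of length T, a lower bound
    for u_xx on a box, and a comparison of the two resulting numbers. *)
Lemma LpQ_norm_gap (p : R) (uxx f : R * R -> R) (w : R -> R)
    (C T W m a b c d N : R) :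
  1 <= p -> 0 <= C -> 0 <= T -> 0 <= W -> 0 <= m -> 0 < a -> a <= b -> b < 1 -> c <= d ->
  0 <= N ->
  measurable_fun (@Q R : set (borel_plane R)) uxx ->
  measurable_fun (@Q R : set (borel_plane R)) f ->
  measurable_fun (setT : set (measurableTypeR R)) w ->
  (forall x, 0 <= w x <= 1) -> (\int[mu]_x (w x)%:E = W%:E)%E ->
  (forall t x, 0 < t < 1 ->
     `|f (t, x)| <= C * (\1_(`[0, T]%classic) t * w x)) ->
  (forall t x, a <= t <= b -> c <= x <= d -> m <= `|uxx (t, x)|) ->
  N * (C * (T * W) `^ p^-1) < m * ((b - a) * (d - c)) `^ p^-1 ->
  ~ (LpQ_norm p uxx <= N%:E * LpQ_norm p f)%E.
Proof.
move=> p1 C0 T0 W0 m0 a0 ab b1 cd N0 muxx mf mw w01 wW fC um gap; apply/negP.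
have p0 : 0 < p by rewrite (lt_le_trans _ p1).
rewrite -ltNge.
have mQf g : measurable_fun (@Q R : set (borel_plane R)) g ->
    measurable_fun (setT : set (borel_plane R)) (g \_ (@Q R)).
  by move=> mg; apply/(measurable_restrictT _ measurable_Q).
have ind0 t : 0 <= \1_(`[0, T]%classic) t :> R.
  by rewrite indicE; case: (_ \in _).
apply: (@le_lt_trans _ _ (N%:E * (C * (T * W) `^ p^-1)%:E)%E).
  apply: lee_wpmul2l; first by rewrite lee_fin.
  apply: (Lnorm_plane_le (w := w)) => //; first exact: mQf.
  move=> t x; rewrite /patch; case: ifPn => [|_].
    by rewrite inE => /(fC t x).
  by rewrite normr0 !mulr_ge0//; have /andP[] := w01 x.
apply: (@lt_le_trans _ _ (m * ((b - a) * (d - c)) `^ p^-1)%:E).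
  by rewrite -EFinM lte_fin.
apply: Lnorm_plane_ge => //; first exact: mQf.
move=> t x /andP[at_ tb] xcd; rewrite /patch mem_set.
  by apply: um => //; rewrite at_.
by rewrite /Q/= (lt_le_trans a0)//= (le_lt_trans tb).
Qed.

End plane_calculus.

(** * One-variable calculus: gluing and cutoffs *)

Section one_variable.
Variable R : realType.
Implicit Types (f g : R -> R) (c x : R).

(** The difference quotient at c of the glued function is everywhere one of the
    two given difference quotients, and both have the same limit. *)
Lemma is_derive_glue f1 f2 d1 d2 c :
  (forall x : R, x <= c -> is_derive x 1 f1 (d1 x)) ->
  (forall x : R, c <= x -> is_derive x 1 f2 (d2 x)) ->
  f1 c = f2 c -> d1 c = d2 c ->
  forall x : R, is_derive x 1 (fun y => if y <= c then f1 y else f2 y)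
    (if x <= c then d1 x else d2 x).
Proof.
move=> D1 D2 f12 d12 x.
have [xc|cx|->] := ltgtP x c.
- apply: (@near_eq_is_derive _ _ _ f1); last exact/D1/ltW.
  by near=> y; rewrite ifT// ltW//; near: y; exact: lt_nbhsl.
- apply: (@near_eq_is_derive _ _ _ f2); last exact/D2/ltW.
  by near=> y; rewrite ifF//; apply/negbTE; rewrite -ltNge; near: y; exact: lt_nbhsr.
have [C1 E1] := D1 c (lexx c); have [C2 E2] := D2 c (lexx c).
set F := fun y => _.
have cvgF : (fun h => h^-1 *: ((F \o shift c) (h *: (1 : R)) - F c)) @ 0^' --> d1 c.
  have /= L1 : (fun h => h^-1 *: ((f1 \o shift c) (h *: (1 : R)) - f1 c)) @ 0^' --> d1 c.
    by rewrite -E1; exact: C1.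
  have /= L2 : (fun h => h^-1 *: ((f2 \o shift c) (h *: (1 : R)) - f2 c)) @ 0^' --> d1 c.
    by rewrite d12 -E2; exact: C2.
  move=> A nA.
  have N1 : \forall h \near 0^', A (h^-1 *: (f1 (h *: (1 : R) + c) - f1 c)).
    exact: L1.
  have N2 : \forall h \near 0^', A (h^-1 *: (f2 (h *: (1 : R) + c) - f2 c)).
    exact: L2.
  have Fc : F c = f1 c by rewrite /F lexx.
  suff : \forall h \near 0^', A (h^-1 *: (F (h *: (1 : R) + c) - F c)) by [].
  near=> h; rewrite Fc {1}/F; case: ifP => _; first by near: h.
  by rewrite f12; near: h.
constructor; first by apply/cvg_ex; exists (d1 c).
exact: (cvg_lim _ cvgF).
Unshelve. all: by end_near. Qed.

Lemma continuous_glue f1 f2 c :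
  (forall x : R, x <= c -> {for x, continuous f1}) ->
  (forall x : R, c <= x -> {for x, continuous f2}) ->
  f1 c = f2 c ->
  continuous (fun y => if y <= c then f1 y else f2 y).
Proof.
move=> C1 C2 f12 x.
have [xc|cx|->] := ltgtP x c.
- have := C1 x (ltW xc); rewrite /prop_for /continuous_at /= ltW// => L.
  apply: cvg_trans L; apply: near_eq_cvg.
  by near=> y; rewrite ifT// ltW//; near: y; exact: lt_nbhsl.
- have := C2 x (ltW cx); rewrite /prop_for /continuous_at /= leNgt cx/= => L.
  apply: cvg_trans L; apply: near_eq_cvg.
  by near=> y; rewrite ifF//; apply/negbTE; rewrite -ltNge; near: y; exact: lt_nbhsr.
rewrite /continuous_at lexx => A nA.
have L1 := C1 c (lexx c); have L2 := C2 c (lexx c).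
rewrite /prop_for /continuous_at -f12 in L2.
have N1 : \forall y \near c, A (f1 y) by exact: L1.
have N2 : \forall y \near c, A (f2 y) by exact: L2.
suff : \forall y \near c, A (if y <= c then f1 y else f2 y) by [].
by near=> y; case: ifP => _; near: y.
Unshelve. all: by end_near. Qed.

Definition C1fun f df := continuous df /\ forall x : R, is_derive x 1 f (df x).

Lemma C1fun_continuous f df : C1fun f df -> continuous f.
Proof.
move=> [_ D] x; apply: differentiable_continuous; apply/derivable1_diffP.
by case: (D x).
Qed.

(** Truncated powers are the building blocks of all cutoffs below: of class C^1
    from the exponent 2 on, and of class C^2 from the exponent 3 on. *)
Definition pospow (n : nat) (x : R) : R := Num.max 0 x ^+ n.

Lemma pospow_continuous n : continuous (pospow n).
Proof.
move=> x; apply: (@continuous_comp _ _ _ (fun y : R => Num.max 0 y) (fun y => y ^+ n)).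
  by apply: continuous_max; [exact: cvg_cst|exact: cvg_id].
exact: exprn_continuous.
Qed.

Lemma C1fun_pospow n : C1fun (pospow n.+2) (fun x => n.+2%:R * pospow n.+1 x).
Proof.
split.
  by move=> x; apply: cvgM; [exact: cvg_cst|exact: pospow_continuous].
move=> x.
have -> : pospow n.+2 = fun y : R => if y <= 0 then 0 else y ^+ n.+2.
  apply/funext => y; by rewrite /pospow; case: leP => // y0; rewrite expr0n.
have -> : n.+2%:R * pospow n.+1 x = if x <= 0 then 0 else n.+2%:R * x ^+ n.+1.
  by rewrite /pospow; case: leP => // y0; rewrite expr0n mulr0.
apply: (@is_derive_glue (fun=> 0) (fun y => y ^+ n.+2) (fun=> 0)
  (fun y => n.+2%:R * y ^+ n.+1)).
- move=> y _; apply: DeriveDef; first exact: exprn_derivable.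
  by rewrite exp_derive /GRing.scale/= mulr1.
- by rewrite expr0n.
- by rewrite expr0n mulr0.
Qed.

(** A quadratic spline with knots 0, 1/2, 1: its second derivative is 4 on
    (0, 1/2), -4 on (1/2, 1) and 0 elsewhere, so that it rises from 0 to 1 and is
    then constant. One continuous derivative is enough for a cutoff in time. *)
Definition smoothstep (x : R) : R :=
  2 * pospow 2 x - 4 * pospow 2 (x - 2^-1) + 2 * pospow 2 (x - 1).

Definition dsmoothstep (x : R) : R :=
  4 * pospow 1 x - 8 * pospow 1 (x - 2^-1) + 4 * pospow 1 (x - 1).

Lemma C1fun_comp f df g dg : C1fun f df -> C1fun g dg ->
  C1fun (fun x => f (g x)) (fun x => df (g x) * dg x).
Proof.
move=> Cf Cg; have cg := C1fun_continuous Cg; case: Cf => cdf Df; case: Cg => cdg Dg.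
split.
  move=> x; apply: cvgM; last exact: cdg.
  by apply: (@continuous_comp _ _ _ g df); [exact: cg|exact: cdf].
move=> x; have h1 := Df (g x); have h2 := Dg x.
exact: (@is_derive1_comp _ f g).
Qed.

Lemma C1fun_cst (c : R) : C1fun (fun=> c) (fun=> 0).
Proof.
split; first by move=> x; exact: cvg_cst.
by move=> x; exact: is_derive_cst.
Qed.

Lemma C1fun_affine (a b : R) : C1fun (fun x => a * x + b) (fun=> a).
Proof.
split; first by move=> x; exact: cvg_cst.
move=> x; apply: is_derive_eq.
by rewrite addr0 /GRing.scale/= mulr1.
Qed.

Lemma C1funD f df g dg : C1fun f df -> C1fun g dg ->
  C1fun (fun x => f x + g x) (fun x => df x + dg x).
Proof.
move=> [cf Df] [cg Dg]; split.
  by move=> x; apply: cvgD; [exact: cf|exact: cg].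
by move=> x; have h1 := Df x; have h2 := Dg x; apply: is_derive_eq.
Qed.

Lemma C1funM f df g dg : C1fun f df -> C1fun g dg ->
  C1fun (fun x => f x * g x) (fun x => df x * g x + f x * dg x).
Proof.
move=> Cf Cg; have cf := C1fun_continuous Cf; have cg := C1fun_continuous Cg.
case: Cf => cdf Df; case: Cg => cdg Dg; split.
  by move=> x; apply: cvgD; apply: cvgM; (exact: cf || exact: cg || exact: cdf || exact: cdg).
move=> x; have h1 := Df x; have h2 := Dg x; apply: is_derive_eq.
by rewrite /GRing.scale/= addrC mulrC.
Qed.

Lemma C1funZ (k : R) f df : C1fun f df ->
  C1fun (fun x => k * f x) (fun x => k * df x).
Proof.
move=> [cf Df]; split.
  by move=> x; apply: cvgM; [exact: cvg_cst|exact: cf].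
move=> x; have h1 := Df x; apply: is_derive_eq.
by rewrite /GRing.scale/=.
Qed.

Lemma C1fun_ext f df g dg : f =1 g -> df =1 dg -> C1fun f df -> C1fun g dg.
Proof. by move=> /funext -> /funext ->. Qed.

Lemma C1fun_smoothstep : C1fun smoothstep dsmoothstep.
Proof.
have S (a k : R) : C1fun (fun x => k * pospow 2 (x - a))
    (fun x => (2 * k) * pospow 1 (x - a)).
  apply: (C1fun_ext _ _ (C1funZ k (C1fun_comp (C1fun_pospow 0) (C1fun_affine 1 (- a))))).
    by move=> x; rewrite mul1r.
  by move=> x; rewrite mul1r mulr1 mulrCA mulrA.
apply: (C1fun_ext _ _ (C1funD (C1funD (S 0 2) (S 2^-1 (-4))) (S 1 2))).
  by move=> x; rewrite /smoothstep subr0 mulNr.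
by move=> x; rewrite /dsmoothstep subr0 mulrN mulNr -!natrM.
Qed.

Lemma smoothstep_le0 x : x <= 0 -> smoothstep x = 0 /\ dsmoothstep x = 0.
Proof.
move=> x0; rewrite /smoothstep /dsmoothstep /pospow.
rewrite (max_idPl _)// (max_idPl _); last by lra.
rewrite (max_idPl _); last by lra.
by rewrite !expr0n !mulr0 subr0 addr0.
Qed.

Lemma smoothstep_ge1 x : 1 <= x -> smoothstep x = 1 /\ dsmoothstep x = 0.
Proof.
move=> x0; rewrite /smoothstep /dsmoothstep /pospow.
rewrite (max_idPr _); last by lra.
rewrite (max_idPr _); last by lra.
rewrite (max_idPr _); last by lra.
by split; field.
Qed.

Lemma smoothstep_bound x :
  (0 <= smoothstep x <= 1) /\ (0 <= dsmoothstep x <= 2).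
Proof.
have [x0|x0] := leP x 0.
  by have [-> ->] := smoothstep_le0 x0; rewrite !lexx ler01 ler0n.
have [x1|x1] := leP 1 x.
  by have [-> ->] := smoothstep_ge1 x1; rewrite !lexx ler01 ler0n.
rewrite /smoothstep /dsmoothstep /pospow (max_idPr (ltW x0)).
rewrite [Num.max 0 (x - 1)](max_idPl _); last by lra.
have [xh|xh] := leP x 2^-1.
  rewrite (max_idPl _) ?subr_le0// !expr0n !mulr0 !subr0 !addr0 expr1.
  by split; apply/andP; split; nra.
rewrite (max_idPr _); last by lra.
rewrite !expr0n !mulr0 !addr0 !expr1.
by split; apply/andP; split; nra.
Qed.

(** A C^1 reparametrisation of time that is the identity for s >= e and never
    goes below e / 2. Composed with it, a function defined for positive times
    only becomes a function on the whole plane that is unchanged for s >= e. *)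
Definition floortime (e s : R) : R := s + (2 * e)^-1 * pospow 2 (e - s).

Definition dfloortime (e s : R) : R := 1 - e^-1 * pospow 1 (e - s).

Lemma C1fun_floortime e : C1fun (floortime e) (dfloortime e).
Proof.
apply: (C1fun_ext _ _ (C1funD (C1fun_affine 1 0)
  (C1funZ (2 * e)^-1 (C1fun_comp (C1fun_pospow 0) (C1fun_affine (-1) e))))).
  by move=> s; rewrite /floortime mul1r addr0 mulN1r addrC [- s + e]addrC addrC.
move=> s; rewrite /dfloortime mulrN1 mulrN mulN1r [- s + e]addrC invfM.
by rewrite mulrACA mulVf ?mul1r// pnatr_eq0.
Qed.

Lemma floortime_id e s : e <= s -> floortime e s = s /\ dfloortime e s = 1.
Proof.
move=> es; rewrite /floortime /dfloortime /pospow (max_idPl _) ?subr_le0//.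
by rewrite !expr0n !mulr0 addr0 subr0.
Qed.

Lemma floortime_ge e s : 0 < e -> e / 2 <= floortime e s.
Proof.
move=> e0; have [es|es] := leP e s.
  by rewrite (floortime_id es).1; lra.
rewrite /floortime /pospow (max_idPr _); last by lra.
rewrite -subr_ge0.
(* Below e the function is the parabola tangent to the diagonal at e. *)
have -> : s + (2 * e)^-1 * (e - s) ^+ 2 - e / 2 = (2 * e)^-1 * s ^+ 2.
  by field; rewrite gt_eqF.
by rewrite mulr_ge0 ?sqr_ge0// invr_ge0; lra.
Qed.

End one_variable.

(** * From the half plane to the whole plane *)

Section half_plane_products.
Variable R : realType.

(** The regularity of C12, required for positive times only, and stated on
    slices, the form in which it is verified for explicit formulas. *)
Definition half_C12 (v vt vx vxx : R * R -> R) := forall s y : R, 0 < s ->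
  [/\ is_derive s 1 (fun s' => v (s', y)) (vt (s, y)),
      is_derive y 1 (fun y' => v (s, y')) (vx (s, y)) &
      is_derive y 1 (fun y' => vx (s, y')) (vxx (s, y))] /\
  [/\ {for (s, y), continuous v}, {for (s, y), continuous vt},
      {for (s, y), continuous vx} & {for (s, y), continuous vxx}].

Lemma continuous_fst_comp (f : R -> R) : continuous f ->
  continuous (fun z : R * R => f z.1).
Proof.
by move=> cf z; apply: (@continuous_comp _ _ _ fst f); [exact: cvg_fst|exact: cf].
Qed.

Lemma continuous_snd_comp (f : R -> R) : continuous f ->
  continuous (fun z : R * R => f z.2).
Proof.
by move=> cf z; apply: (@continuous_comp _ _ _ snd f); [exact: cvg_snd|exact: cf].
Qed.

Lemma continuous_retime (r : R -> R) (f : R * R -> R) : continuous r ->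
  (forall t, 0 < r t) ->
  (forall s y, 0 < s -> {for (s, y), continuous f}) ->
  continuous (fun z : R * R => f (r z.1, z.2)).
Proof.
move=> cr r0 cf z.
apply: (@continuous_comp _ _ _ (fun z : R * R => (r z.1, z.2)) f).
  apply: (@cvg_pair _ _ _ (nbhs z) (nbhs (r z.1)) (nbhs z.2) _ _ _
    (fun z : R * R => r z.1) snd); first exact: continuous_fst_comp.
  exact: cvg_snd.
exact: cf.
Qed.

(** All functions used are of this form: a cutoff in time, a cutoff in space, and
    an explicit function of a positive, reparametrised time. The derivatives are
    kept in exactly the shape in which they are estimated later. *)
Lemma C12_product (ze dze ch dch ddch r dr : R -> R) (v vt vx vxx : R * R -> R) :
  C1fun ze dze -> C1fun ch dch -> C1fun dch ddch -> C1fun r dr ->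
  (forall t, 0 < r t) -> half_C12 v vt vx vxx ->
  C12 (fun z => ze z.1 * ch z.2 * v (r z.1, z.2))
    (fun z => ch z.2 * (dze z.1 * v (r z.1, z.2) +
                        ze z.1 * dr z.1 * vt (r z.1, z.2)))
    (fun z => ze z.1 * (dch z.2 * v (r z.1, z.2) + ch z.2 * vx (r z.1, z.2)))
    (fun z => ze z.1 * (ddch z.2 * v (r z.1, z.2) +
       2 * dch z.2 * vx (r z.1, z.2) + ch z.2 * vxx (r z.1, z.2))).
Proof.
move=> Cze Cch Cdch Cr r0 Hv.
have cze := continuous_fst_comp (C1fun_continuous Cze).
have cdze := continuous_fst_comp Cze.1.
have cch := continuous_snd_comp (C1fun_continuous Cch).
have cdch := continuous_snd_comp Cch.1.
have cddch := continuous_snd_comp Cdch.1.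
have cdr := continuous_fst_comp Cr.1.
have cr := C1fun_continuous Cr.
have cv := continuous_retime cr r0
  (fun s y s0 => let: conj _ (And4 h _ _ _) := Hv s y s0 in h).
have cvt := continuous_retime cr r0
  (fun s y s0 => let: conj _ (And4 _ h _ _) := Hv s y s0 in h).
have cvx := continuous_retime cr r0
  (fun s y s0 => let: conj _ (And4 _ _ h _) := Hv s y s0 in h).
have cvxx := continuous_retime cr r0
  (fun s y s0 => let: conj _ (And4 _ _ _ h) := Hv s y s0 in h).
have cM (f g : R * R -> R) : continuous f -> continuous g ->
    continuous (fun z => f z * g z).
  by move=> cf cg z; apply: cvgM; [exact: cf|exact: cg].
have cD (f g : R * R -> R) : continuous f -> continuous g ->
    continuous (fun z => f z + g z).
  by move=> cf cg z; apply: cvgD; [exact: cf|exact: cg].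
have c2 : continuous (fun z : R * R => 2 * dch z.2).
  by move=> z; apply: cvgM; [exact: cvg_cst|exact: cdch].
have cu := cM _ _ (cM _ _ cze cch) cv.
have cut := cM _ _ cch (cD _ _ (cM _ _ cdze cv) (cM _ _ (cM _ _ cze cdr) cvt)).
have cux := cM _ _ cze (cD _ _ (cM _ _ cdch cv) (cM _ _ cch cvx)).
have cuxx := cM _ _ cze (cD _ _ (cD _ _ (cM _ _ cddch cv) (cM _ _ c2 cvx)) (cM _ _ cch cvxx)).
split; split => //; move=> [t x].
- apply/slice_t_deriv => /=.
  have [[Dv _ _] _] := Hv (r t) x (r0 t).
  have Dr := Cr.2 t; have Dze := Cze.2 t.
  have Dvr : is_derive (t : R) 1 (fun t' => v (r t', x)) (vt (r t, x) * dr t).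
    exact: (@is_derive1_comp _ (fun s => v (s, x)) r).
  apply: is_derive_eq; rewrite /GRing.scale/=; ring.
- apply/slice_x_deriv => /=.
  have [[_ Dv _] _] := Hv (r t) x (r0 t).
  have Dch := Cch.2 x.
  apply: is_derive_eq; rewrite /GRing.scale/=; ring.
- apply/slice_x_deriv => /=.
  have [[_ Dv Dvx] _] := Hv (r t) x (r0 t).
  have Dch := Cch.2 x; have Ddch := Cdch.2 x.
  apply: is_derive_eq; rewrite /GRing.scale/=; ring.
Qed.

(** A continuous function with support in a rectangle is bounded there, while
    the weight is bounded below there. *)
Lemma strip_decay_compact (f : R * R -> R) (T M : R) : continuous f ->
  0 <= T -> 0 <= M ->
  (forall t x, ~ (0 <= t <= T /\ - M <= x <= M) -> f (t, x) = 0) ->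
  strip_decay f.
Proof.
move=> cf T0 M0 f0.
have cB : compact (`[0, T]%classic `*` `[- M, M]%classic : set (R * R)).
  by apply: compact_setX; exact: segment_compact.
have := @continuous_compact _ _ f _ (continuous_subspaceT cf) cB.
move=> /compact_bounded [K [Kr fK]].
exists (Num.max 1 (K + 1) * (1 + M ^+ 2)), T; split => //.
  by rewrite mulr_ge0 ?le_max ?ler01// addr_ge0 ?sqr_ge0.
move=> t x; have /andP[w0 _] := cauchy_weight01 1 x.
have ind0 : 0 <= \1_(`[0, T]%classic) t :> R.
  by rewrite indicE; case: (_ \in _).
have [[tT xM]|txN] := pselect (0 <= t <= T /\ - M <= x <= M); last first.
  rewrite f0// normr0; apply: mulr_ge0; last exact: mulr_ge0.
  by rewrite mulr_ge0 ?le_max ?ler01// addr_ge0 ?sqr_ge0.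
rewrite indicE mem_set/= ?in_itv//= mul1r -mulrA.
have fb : `|f (t, x)| <= Num.max 1 (K + 1).
  apply: (fK (Num.max 1 (K + 1))); first by rewrite lt_max ltrDl ltr01 orbT.
  by exists (t, x) => //; split; rewrite /= in_itv.
apply: (le_trans fb); rewrite ler_peMr ?le_max ?ler01//.
rewrite /cauchy_weight divr1 ler_pdivlMr ?mul1r ?lerD2l; last first.
  by rewrite (@lt_le_trans _ _ 1)// lerDl sqr_ge0.
by move: xM => /andP[]; nra.
Qed.

End half_plane_products.

(** * The profile of a slowly spreading self-similar solution *)

Section self_similar_profile.
Variable R : realType.
Variable k : R.

(** The profile as a function of s = x^2 / (9 t). With q = sqrt s, the equation
    u_t = a u_xx for u = t^(-k) H(s) becomes
    - (k H + s H_s) = (a / 9) H_qq, with H_qq = 2 H_s + 4 s H_ss,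
    so that both sides must change sign at the same point, chosen to be s = 1.
    Inside, H is a quadratic polynomial in s with H = 1 and H_s = - k at s = 1,
    which makes k H + s H_s vanish there; its last coefficient is such that H_qq
    vanishes there too. *)
Definition prof_in (s : R) : R := 1 + 5 / 4 * k - 3 / 2 * k * s + k / 4 * s ^+ 2.
Definition dprof_in (s : R) : R := - (3 / 2 * k) + k / 2 * s.

(** Outside, log H is a quadratic polynomial in q. Its slope - 2 k at q = 1
    matches the inner part, and its second derivative - 4 k^2 makes
    H_qq / H = (log H)_q^2 + (log H)_qq vanish at q = 1. *)
Definition prof_out (s : R) : R :=
  expR (- (2 * k * (Num.sqrt s - 1)) - 2 * k ^+ 2 * (Num.sqrt s - 1) ^+ 2).
(** Minus the logarithmic derivative of the outer part with respect to s. *)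
Definition out_rate (s : R) : R :=
  k * (1 - 2 * k) * (Num.sqrt s)^-1 + 2 * k ^+ 2.
Definition dprof_out (s : R) : R := - (out_rate s * prof_out s).
Definition ddprof_out (s : R) : R :=
  (out_rate s ^+ 2 + k * (1 - 2 * k) / 2 * (Num.sqrt s)^-1 ^+ 3) * prof_out s.

Definition prof (s : R) : R := if s <= 1 then prof_in s else prof_out s.
Definition dprof (s : R) : R := if s <= 1 then dprof_in s else dprof_out s.
Definition ddprof (s : R) : R := if s <= 1 then k / 2 else ddprof_out s.

Lemma prof_in_deriv (s : R) : is_derive s 1 prof_in (dprof_in s).
Proof.
have H1 := (C1fun_affine (- (3 / 2 * k)) (1 + 5 / 4 * k)).2 s.
have H2 := (C1funM (C1fun_affine (k / 4) 0) (C1fun_affine 1 0)).2 s.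
have -> : prof_in = fun s => (- (3 / 2 * k) * s + (1 + 5 / 4 * k)) +
   ((k / 4 * s + 0) * (1 * s + 0)).
  by apply/funext => y; rewrite /prof_in; ring.
by apply: is_derive_eq; rewrite /dprof_in; field.
Qed.

Lemma dprof_in_deriv (s : R) : is_derive s 1 dprof_in (k / 2).
Proof.
have H1 := (C1fun_affine (k / 2) (- (3 / 2 * k))).2 s.
have -> : dprof_in = fun s => (k / 2 * s + - (3 / 2 * k)).
  by apply/funext => y; rewrite /dprof_in; ring.
exact: H1.
Qed.

Lemma sqrt_inv_deriv (s : R) : 1 <= s ->
  is_derive s 1 (fun s => (Num.sqrt s)^-1) (- (2^-1 * (Num.sqrt s)^-1 ^+ 3)).
Proof.
move=> s1; have s0 : 0 < s by rewrite (lt_le_trans _ s1).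
have q0 : Num.sqrt s != 0 by rewrite gt_eqF// sqrtr_gt0.
have H1 := is_derive1_sqrt s0.
apply: is_derive_eq.
by rewrite /GRing.scale/=; field.
Qed.

Lemma prof_out_deriv (s : R) : 1 <= s -> is_derive s 1 prof_out (dprof_out s).
Proof.
move=> s1; have s0 : 0 < s by rewrite (lt_le_trans _ s1).
have q0 : Num.sqrt s != 0 by rewrite gt_eqF// sqrtr_gt0.
have H1 := is_derive1_sqrt s0.
pose E (q : R) := - (2 * k * (q - 1)) - 2 * k ^+ 2 * (q - 1) ^+ 2.
have HE (q : R) : is_derive q 1 E (- (2 * k) - 4 * k ^+ 2 * (q - 1)).
  have D1 := (C1fun_affine (- (2 * k)) (2 * k)).2 q.
  have D2 := (C1funM (C1fun_affine (- 2 * k ^+ 2) (2 * k ^+ 2)) (C1fun_affine 1 (- 1))).2 q.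
  have -> : E = fun q => (- (2 * k) * q + 2 * k) +
      ((- 2 * k ^+ 2 * q + 2 * k ^+ 2) * (1 * q + - 1)).
    by apply/funext => y; rewrite /E; ring.
  apply: is_derive_eq; ring.
have HEs : is_derive s 1 (fun s => E (Num.sqrt s))
    ((- (2 * k) - 4 * k ^+ 2 * (Num.sqrt s - 1)) * (2 * Num.sqrt s)^-1).
  exact: (@is_derive1_comp _ E (@Num.sqrt R) s _ _ (HE (Num.sqrt s)) H1).
have := @is_derive1_comp _ expR (fun s => E (Num.sqrt s)) s _ _ (is_derive_expR _) HEs.
move=> D; apply: (@is_derive_eq _ _ _ _ _ _ _ _ D).
rewrite /dprof_out /out_rate -[prof_out s]/(expR (E (Num.sqrt s))).
by field.
Qed.

Lemma out_rate_deriv (s : R) : 1 <= s ->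
  is_derive s 1 out_rate (- (k * (1 - 2 * k) / 2 * (Num.sqrt s)^-1 ^+ 3)).
Proof.
move=> s1; have H := sqrt_inv_deriv s1.
rewrite /out_rate; apply: is_derive_eq.
by rewrite /GRing.scale/=; ring.
Qed.

Lemma dprof_out_deriv (s : R) : 1 <= s ->
  is_derive s 1 dprof_out (ddprof_out s).
Proof.
move=> s1; have H1 := prof_out_deriv s1; have H2 := out_rate_deriv s1.
rewrite /dprof_out; apply: is_derive_eq.
rewrite /ddprof_out /dprof_out /GRing.scale/=; ring.
Qed.

Lemma C1fun_prof : C1fun prof dprof.
Proof.
have c1 : dprof_in 1 = dprof_out 1.
  rewrite /dprof_in /dprof_out /out_rate /prof_out sqrtr1 subrr expr0n !mulr0 subr0 oppr0.
  by rewrite expR0; field.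
split.
  apply: continuous_glue => // s hs.
    by apply: differentiable_continuous; apply/derivable1_diffP;
      case: (dprof_in_deriv s).
  by apply: differentiable_continuous; apply/derivable1_diffP;
    case: (dprof_out_deriv hs).
apply: is_derive_glue.
- by move=> s _; exact: prof_in_deriv.
- by move=> s; exact: prof_out_deriv.
- rewrite /prof_in /prof_out sqrtr1 subrr expr0n !mulr0 subr0 oppr0 expR0.
  by field.
- exact: c1.
Qed.

Lemma C1fun_dprof : C1fun dprof ddprof.
Proof.
split.
  apply: continuous_glue.
  - by move=> s _; exact: cvg_cst.
  - move=> s s1; rewrite /prop_for /continuous_at.
    have c1 : {for s, continuous prof_out}.
      by apply: differentiable_continuous; apply/derivable1_diffP;
        case: (prof_out_deriv s1).
    have c2 : {for s, continuous out_rate}.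
      by apply: differentiable_continuous; apply/derivable1_diffP;
        case: (out_rate_deriv s1).
    have c3 : {for s, continuous (fun s => (Num.sqrt s)^-1)}.
      by apply: differentiable_continuous; apply/derivable1_diffP;
        case: (sqrt_inv_deriv s1).
    apply: cvgM; last exact: c1.
    apply: cvgD; first by apply: cvgM; exact: c2.
    apply: cvgM; first exact: cvg_cst.
    by apply: cvgM; [exact: c3|apply: cvgM; exact: c3].
  - rewrite /ddprof_out /out_rate /prof_out sqrtr1 subrr expr0n !mulr0 subr0 oppr0 expR0.
    by field.
apply: is_derive_glue.
- by move=> s _; exact: dprof_in_deriv.
- by move=> s; exact: dprof_out_deriv.
- rewrite /dprof_in /dprof_out /out_rate /prof_out sqrtr1 subrr expr0n !mulr0 subr0 oppr0.
  by rewrite expR0; field.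
- rewrite /ddprof_out /out_rate /prof_out sqrtr1 subrr expr0n !mulr0 subr0 oppr0 expR0.
  by field.
Qed.

(** The quotient of the two sides of the equation for the profile, with the
    common factor 1 - s, respectively q - 1, cancelled. *)
Definition prof_coef (s : R) : R :=
  if s <= 1 then (1 + 5 / 4 * k - (2^-1 + k / 4) * s) / 3
  else (1 + 2 * k * Num.sqrt s) / (16 * k ^+ 2 * (1 + k * (Num.sqrt s - 1))).

Lemma sqrt_ge1 (s : R) : 1 <= s -> 1 <= Num.sqrt s.
Proof. by move=> s1; rewrite -sqrtr1 ler_sqrt// (le_trans _ s1). Qed.

Lemma prof_ode (s : R) : 0 < k -> 0 <= s ->
  - (k * prof s + s * dprof s) = prof_coef s * (2 * dprof s + 4 * s * ddprof s).
Proof.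
move=> k0 s0; rewrite /prof /dprof /ddprof /prof_coef; case: leP => s1.
  by rewrite /prof_in /dprof_in; field.
have q1 := sqrt_ge1 (ltW s1).
rewrite /dprof_out /ddprof_out /out_rate.
move: q1 (sqr_sqrtr s0); move: (prof_out s) (Num.sqrt s) => h q q1 <-.
have q0 : q != 0 by rewrite gt_eqF// (lt_le_trans _ q1).
field; rewrite q0 (gt_eqF k0)/= gt_eqF//.
by rewrite ltr_pwDl// mulr_ge0 ?subr_ge0// ltW.
Qed.

(** The bound k <= 1/4 keeps the quotient above 1/9. The upper bound grows as k
    decreases: a slow decay rate k costs a large ellipticity ratio. *)
Lemma prof_coef_bound (s : R) : 0 < k -> k <= 4^-1 -> 0 <= s ->
  9^-1 <= prof_coef s <= (4 * k ^+ 2)^-1.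
Proof.
move=> k0 k4 s0; rewrite /prof_coef; case: (leP s 1) => s1.
  have K0 : 0 < 4 * k ^+ 2 by rewrite mulr_gt0// exprn_gt0.
  have K1 : 1 <= (4 * k ^+ 2)^-1 by rewrite invf_ge1//; nra.
  by apply/andP; split; nra.
have q1 := sqrt_ge1 (ltW s1); move: (Num.sqrt s) q1 => q q1.
have D0 : 0 < 16 * k ^+ 2 * (1 + k * (q - 1)).
  by rewrite mulr_gt0 ?mulr_gt0 ?exprn_gt0//; nra.
apply/andP; split.
  rewrite ler_pdivlMr//.
  have z1 : 16 * k ^+ 2 <= 1 by nra.
  have y0 : 0 <= 1 + k * (q - 1) by nra.
  by have := ler_wpM2r y0 z1; nra.
rewrite ler_pdivrMr//.
have -> : (4 * k ^+ 2)^-1 * (16 * k ^+ 2 * (1 + k * (q - 1))) =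
    4 * (1 + k * (q - 1)) by field; rewrite gt_eqF.
have y0 : 0 <= k * (q - 1) by nra.
by lra.
Qed.

(** Inside the region s < 1 the function is concave in x with an explicit second
    derivative; this is what bounds |u_xx| from below near x = 0. *)
Lemma prof_concave (s : R) : 0 <= s <= 1 ->
  dprof s + 2 * s * ddprof s = - (3 / 2 * k * (1 - s)).
Proof.
by move=> /andP[s0 s1]; rewrite /dprof /ddprof s1 /dprof_in; field.
Qed.

(** The outer part is dominated by exp (- k^2 s), since
    2 k (q - 1) + 2 k^2 (q - 1)^2 = k^2 q^2 + k^2 (q - 2)^2 - 2 k^2 + 2 k (q - 1),
    and its derivatives are multiples of it by bounded factors. The decay
    (1 + s)^(-2) is one power more than needed for a weight in x, because the
    derivatives of u carry factors that grow at most like s. *)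
Lemma prof_decay : 0 < k -> k <= 4^-1 -> exists2 C : R, 0 < C & forall s, 0 <= s ->
  [/\ `|prof s| <= C / (1 + s) ^+ 2, `|dprof s| <= C / (1 + s) ^+ 2 &
      `|ddprof s| <= C / (1 + s) ^+ 2].
Proof.
move=> k0 k4; pose C0 := expR (2 * k ^+ 2) * (4 / k ^+ 4).
have C00 : 0 < C0 by rewrite mulr_gt0 ?expR_gt0 ?divr_gt0 ?exprn_gt0.
exists (C0 + 12); first by rewrite addr_gt0.
move=> s s0; have s2 : 0 < (1 + s) ^+ 2 by rewrite exprn_gt0//; lra.
have bnd (h : R) : `|h| * (1 + s) ^+ 2 <= C0 + 12 -> `|h| <= (C0 + 12) / (1 + s) ^+ 2.
  by rewrite ler_pdivlMr.
have [s1|s1] := leP s 1.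
  have q4 : (1 + s) ^+ 2 <= 4 by nra.
  have small (h : R) : - 3 <= h <= 3 -> `|h| * (1 + s) ^+ 2 <= C0 + 12.
    rewrite -ler_norml => h3; have := normr_ge0 h; nra.
  rewrite /prof /dprof /ddprof s1; split; apply: bnd; apply: small.
  - by rewrite /prof_in; apply/andP; split; nra.
  - by rewrite /dprof_in; apply/andP; split; nra.
  - by apply/andP; split; nra.
have q1 := sqrt_ge1 (ltW s1).
have out : `|prof_out s| * (1 + s) ^+ 2 <= C0.
  rewrite ger0_norm ?expR_ge0//.
  have E1 : - (2 * k * (Num.sqrt s - 1)) - 2 * k ^+ 2 * (Num.sqrt s - 1) ^+ 2
      <= 2 * k ^+ 2 + - (k ^+ 2 * s).
    move: q1 (sqr_sqrtr s0); move: (Num.sqrt s) => q q1 <-.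
    have k2 : 0 <= k ^+ 2 by rewrite sqr_ge0.
    have : 0 <= k * (q - 1) by nra.
    have : 0 <= k ^+ 2 * (q - 2) ^+ 2 by rewrite mulr_ge0 ?sqr_ge0.
    nra.
  (* Squaring 1 + y <= exp y, at y = k^2 s / 2. *)
  have E2 : expR (- (k ^+ 2 * s)) * (1 + s) ^+ 2 <= 4 / k ^+ 4.
    have L : k ^+ 2 / 2 * (1 + s) <= expR (k ^+ 2 / 2 * s).
      by apply: le_trans (expR_ge1Dx _); nra.
    have L0 : 0 <= k ^+ 2 / 2 * (1 + s) by nra.
    have L2 : (k ^+ 2 / 2 * (1 + s)) ^+ 2 <= expR (k ^+ 2 * s).
      have -> : k ^+ 2 * s = k ^+ 2 / 2 * s + k ^+ 2 / 2 * s by field.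
      by rewrite expRD -expr2 lerXn2r// nnegrE// expR_ge0.
    rewrite expRN mulrC ler_pdivrMr ?expR_gt0// mulrC -ler_pdivrMr ?divr_gt0 ?exprn_gt0//.
    apply: le_trans L2; rewrite le_eqVlt; apply/orP; left; apply/eqP.
    by field; rewrite gt_eqF.
  apply: (@le_trans _ _ (expR (2 * k ^+ 2 + - (k ^+ 2 * s)) * (1 + s) ^+ 2)).
    by rewrite ler_pM2r// ler_expR.
  by rewrite expRD -mulrA ler_pM2l ?expR_gt0.
have iq : 0 < (Num.sqrt s)^-1 <= 1.
  by rewrite invr_gt0 (lt_le_trans _ q1)//= invf_le1// (lt_le_trans _ q1).
have rate : 0 <= out_rate s <= 1.
  rewrite /out_rate; case/andP: iq; move: (Num.sqrt s)^-1 => v v0 v1.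
  by apply/andP; split; nra.
have mulout (h : R) : 0 <= h <= 1 -> `|h * prof_out s| * (1 + s) ^+ 2 <= C0 + 12.
  move=> /andP[h0 h1]; rewrite normrM (ger0_norm h0) -mulrA.
  have y0 : 0 <= `|prof_out s| * (1 + s) ^+ 2 by apply: mulr_ge0 => //; exact: ltW.
  apply: (@le_trans _ _ (`|prof_out s| * (1 + s) ^+ 2)); first exact: ler_piMl.
  by apply: (le_trans out); rewrite lerDl.
rewrite /prof /dprof /ddprof (lt_geF s1); split; apply: bnd.
- by have := mulout 1; rewrite mul1r; apply; rewrite lexx ler01.
- by rewrite /dprof_out normrN; exact: mulout.
- apply: mulout; case/andP: rate; set r := out_rate s => r0 r1.
  have : 0 <= (Num.sqrt s)^-1 ^+ 3 <= 1.
    by case/andP: iq => v0 v1; rewrite exprn_ge0 ?exprn_ile1//; exact: ltW.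
  case/andP; set v := _ ^+ 3 => v0 v1.
  have c0 : 0 <= k * (1 - 2 * k) / 2 by nra.
  have c1 : k * (1 - 2 * k) / 2 <= 2^-1 by nra.
  have r2 : r <= 2^-1.
    rewrite /r /out_rate; case/andP: iq; move: (Num.sqrt s)^-1 => u u0 u1; nra.
  have rr : r ^+ 2 <= 4^-1 by nra.
  have := mulr_ge0 c0 v0; have := ler_piMr c0 v1; have := sqr_ge0 r.
  by move=> r20 cv1 cv0; apply/andP; split; lra.
Qed.

End self_similar_profile.

(** * The self-similar solution *)

Section self_similar_solution.
Variable R : realType.
Variable k : R.
Implicit Types z : R * R.

(** The constant 9 raises the coefficient of the equation above 1. *)
Definition selfsim_var z : R := z.2 ^+ 2 / (9 * z.1).
Definition selfsim z : R := z.1 `^ (- k) * prof k (selfsim_var z).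
Definition selfsim_t z : R :=
  - (z.1 `^ (- k) / z.1 *
     (k * prof k (selfsim_var z) + selfsim_var z * dprof k (selfsim_var z))).
Definition selfsim_x z : R :=
  z.1 `^ (- k) * (dprof k (selfsim_var z) * (2 * z.2 / (9 * z.1))).
Definition selfsim_xx z : R :=
  z.1 `^ (- k) * (dprof k (selfsim_var z) * (2 / (9 * z.1)) +
                  ddprof k (selfsim_var z) * (2 * z.2 / (9 * z.1)) ^+ 2).

Lemma selfsim_var_x_deriv (s y : R) :
  is_derive y 1 (fun y => selfsim_var (s, y)) (2 * y / (9 * s)).
Proof.
rewrite /selfsim_var/=.
have -> : (fun y : R => y ^+ 2 / (9 * s)) = (fun y => (9 * s)^-1 * (y * y)).
  by apply/funext => w; rewrite mulrC expr2.
apply: is_derive_eq; rewrite /GRing.scale/=; ring.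
Qed.

Lemma selfsim_var_t_deriv (s y : R) : 0 < s ->
  is_derive s 1 (fun s => selfsim_var (s, y)) (- (selfsim_var (s, y) / s)).
Proof.
move=> s0; rewrite /selfsim_var/=.
have -> : (fun s : R => y ^+ 2 / (9 * s)) = (fun s => (y ^+ 2 / 9) * s^-1).
  by apply/funext => w; rewrite invfM mulrA.
have s1 : s != 0 by rewrite gt_eqF.
have Dinv : is_derive s 1 (fun s : R => s^-1) (- s ^- 2 *: 1).
  exact: (is_deriveV s1 (is_derive_id s (1 : R))).
have := @is_deriveZ _ _ _ (fun s : R => s^-1) (y ^+ 2 / 9) s 1 _ Dinv.
move=> D; apply: (@is_derive_eq _ _ _ _ _ _ _ _ D).
by rewrite /GRing.scale/=; field.
Qed.

Lemma selfsim_var_continuous (s y : R) : 0 < s -> {for (s, y), continuous selfsim_var}.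
Proof.
move=> s0; rewrite /selfsim_var; apply: cvgM.
  by apply: cvgM; exact: cvg_snd.
apply: cvgV; first by rewrite /= mulf_neq0 ?pnatr_eq0// gt_eqF.
by apply: cvgM; [exact: cvg_cst|exact: cvg_fst].
Qed.

Lemma powR_fst_continuous (s y a : R) : 0 < s ->
  {for (s, y), continuous (fun z : R * R => z.1 `^ a)}.
Proof.
move=> s0; apply: (@continuous_comp _ _ _ fst (fun s : R => s `^ a)).
  exact: cvg_fst.
apply: differentiable_continuous; apply/derivable1_diffP.
by case: (powR_deriv a s0).
Qed.

Lemma selfsim_half_C12 : half_C12 selfsim selfsim_t selfsim_x selfsim_xx.
Proof.
move=> s y s0; have sN : s != 0 by rewrite gt_eqF.
have Dp := powR_deriv (- k) s0.
have Cp := C1fun_prof k; have Cdp := C1fun_dprof k.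
have Dst := selfsim_var_t_deriv y s0.
have Dsx := selfsim_var_x_deriv s y.
have comp f df (v d : R) g : C1fun f df -> is_derive v 1 g d ->
    is_derive v 1 (fun v => f (g v)) (df (g v) * d).
  by move=> Cf Dg; apply: (@is_derive1_comp _ f g); first exact: Cf.2.
have H1 := comp _ _ _ _ _ Cp Dst; have H2 := comp _ _ _ _ _ Cp Dsx.
have H3 := comp _ _ _ _ _ Cdp Dsx.
have H4 : is_derive y 1 (fun y => 2 * y / (9 * s)) (2 / (9 * s)).
  have -> : (fun y => 2 * y / (9 * s)) = (fun y => (2 / (9 * s)) * y).
    by apply/funext => w; rewrite mulrAC.
  by apply: is_derive_eq; rewrite /GRing.scale/= mulr1.
have cs := @selfsim_var_continuous s y s0; have cp := @powR_fst_continuous s y (- k) s0.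
have ccomp (f : R -> R) : continuous f ->
    {for (s, y), continuous (fun z => f (selfsim_var z))}.
  by move=> cf; apply: (@continuous_comp _ _ _ selfsim_var f); [exact: cs|exact: cf].
have c0 := ccomp _ (C1fun_continuous Cp); have c1 := ccomp _ (C1fun_continuous Cdp);
  have c2 := ccomp _ Cdp.1.
have ci : {for (s, y), continuous (fun z : R * R => (9 * z.1)^-1)}.
  apply: cvgV; first by rewrite /= mulf_neq0 ?pnatr_eq0.
  by apply: cvgM; [exact: cvg_cst|exact: cvg_fst].
have cx : {for (s, y), continuous (fun z : R * R => 2 * z.2 / (9 * z.1))}.
  by apply: cvgM; [apply: cvgM; [exact: cvg_cst|exact: cvg_snd]|exact: ci].
split; split.
- rewrite /selfsim /selfsim_t/=; apply: is_derive_eq; rewrite /GRing.scale/=; by field.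
- rewrite /selfsim /selfsim_x/=; apply: is_derive_eq; rewrite /GRing.scale/=; by field.
- rewrite /selfsim_x /selfsim_xx/=; apply: is_derive_eq; rewrite /GRing.scale/=; by field.
- by apply: cvgM; [exact: cp|exact: c0].
- apply: cvgN; apply: cvgM.
    by apply: cvgM; [exact: cp|apply: cvgV; [|exact: cvg_fst]].
  by apply: cvgD; apply: cvgM; [exact: cvg_cst|exact: c0|exact: cs|exact: c1].
- by apply: cvgM; [exact: cp|apply: cvgM; [exact: c1|exact: cx]].
- apply: cvgM; [exact: cp|apply: cvgD; apply: cvgM].
  + exact: c1.
  + by apply: cvgM; [exact: cvg_cst|exact: ci].
  + exact: c2.
  + by apply: cvgM; exact: cx.
Qed.

Lemma selfsim_var_ge0 z : 0 < z.1 -> 0 <= selfsim_var z.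
Proof. by move=> z0; rewrite /selfsim_var divr_ge0 ?sqr_ge0// mulr_ge0// ltW. Qed.

Lemma selfsim_eq z : 0 < k -> 0 < z.1 ->
  selfsim_t z = 9 * prof_coef k (selfsim_var z) * selfsim_xx z.
Proof.
move=> k0 z0; have zN : z.1 != 0 by rewrite gt_eqF.
have := prof_ode k0 (selfsim_var_ge0 z0).
have -> : selfsim_xx z = z.1 `^ (- k) / z.1 / 9 *
   (2 * dprof k (selfsim_var z) + 4 * selfsim_var z * ddprof k (selfsim_var z)).
  by rewrite /selfsim_xx /selfsim_var; field.
rewrite /selfsim_t; set A := _ + _; set B := _ + _ => AB.
by rewrite -mulrN AB; field.
Qed.

(** For times in a compact subset of the positive half line x^2 and s are
    comparable, so that the decay of the profile becomes a Cauchy weight in x.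
    The constant may depend on e, since it only serves the membership in L_p. *)
Lemma selfsim_decay (e : R) : 0 < k -> k <= 4^-1 -> 0 < e ->
  exists2 D : R, 0 < D & forall s x, e <= s <= 2 ->
  [/\ `|selfsim (s, x)| <= D * cauchy_weight 1 x,
      `|selfsim_t (s, x)| <= D * cauchy_weight 1 x,
      `|selfsim_x (s, x)| <= D * cauchy_weight 1 x &
      `|selfsim_xx (s, x)| <= D * cauchy_weight 1 x].
Proof.
move=> k0 k4 e0; have [C C0 HC] := prof_decay k0 k4.
have E0 : 0 < e `^ (- k) by rewrite powR_gt0.
have e1 : 0 < 1 + e^-1 by rewrite addr_gt0 ?invr_gt0.
exists (e `^ (- k) * (36 * C * (1 + e^-1))); first by rewrite !mulr_gt0.
move=> s x /andP[es s2]; have s0 : 0 < s by rewrite (lt_le_trans e0).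
have sg0 := @selfsim_var_ge0 (s, x) s0.
have [h0 h1 h2] := HC _ sg0.
have xs : x ^+ 2 = 9 * s * selfsim_var (s, x).
  by rewrite /selfsim_var/=; field; rewrite gt_eqF.
have is0 : 0 < s^-1 by rewrite invr_gt0.
have ise : s^-1 <= e^-1 by rewrite lef_pV2 ?posrE.
have pw0 : 0 <= s `^ (- k) by rewrite powR_ge0.
have pwe : s `^ (- k) <= e `^ (- k).
  by apply: powR_anti => //; rewrite oppr_le0 ltW.
set sg := selfsim_var (s, x) in sg0 h0 h1 h2 xs *.
have r0 : 0 < (1 + sg)^-1 by rewrite invr_gt0; lra.
have r1 : (1 + sg) * (1 + sg)^-1 = 1 by rewrite divff// gt_eqF//; lra.
have rw : (1 + sg)^-1 <= 18 * cauchy_weight 1 x.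
  rewrite /cauchy_weight divr1 xs -[18]invrK -invfM lef_pV2 ?posrE; last 2 first.
  - by lra.
  - have : 0 <= s * sg by rewrite mulr_ge0// ltW.
    by lra.
  have : 0 <= (2 - s) * sg by rewrite mulr_ge0// subr_ge0.
  by lra.
have key (P q : R) : P = s `^ (- k) * q ->
    `|q| <= 2 * C * (1 + e^-1) * (1 + sg)^-1 ->
    `|P| <= e `^ (- k) * (36 * C * (1 + e^-1)) * cauchy_weight 1 x.
  move=> -> qb; rewrite normrM (ger0_norm pw0) -mulrA.
  apply: ler_pM => //; apply: (le_trans qb).
  have -> : 36 * C * (1 + e^-1) * cauchy_weight 1 x =
     2 * C * (1 + e^-1) * (18 * cauchy_weight 1 x) by ring.
  by apply: ler_wpM2l => //; rewrite !mulr_ge0// ltW.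
have hr (h : R) : `|h| <= C / (1 + sg) ^+ 2 -> `|h| <= C * (1 + sg)^-1 ^+ 2.
  by rewrite exprVn.
move: (hr _ h0) (hr _ h1) (hr _ h2) => {hr}.
move: r0 r1 rw key; set r := (1 + sg)^-1 => r0 r1 rw key.
set P0 := prof k sg; set P1 := dprof k sg; set P2 := ddprof k sg => b0 b1 b2.
have rl1 : r <= 1 by nra.
have sr1 : sg * r <= 1 by nra.
have sr0 : 0 <= sg * r by rewrite mulr_ge0// ltW.
have Cr0 : 0 <= C * r by rewrite mulr_ge0// ltW.
have Cr2 : C * r ^+ 2 <= C * r by nra.
have Csr2 : sg * (C * r ^+ 2) <= C * r.
  have -> : sg * (C * r ^+ 2) = (sg * r) * (C * r) by ring.
  by rewrite ler_piMl.
have ie0 : 0 < e^-1 by rewrite invr_gt0.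
have ieCr : 0 <= e^-1 * (C * r) by rewrite mulr_ge0// ltW.
split.
- apply: (key _ P0) => //; lra.
- apply: (key _ (- (s^-1 * (k * P0 + sg * P1)))).
    by rewrite /selfsim_t/= -/sg mulrN mulrA.
  rewrite normrN normrM (gtr0_norm is0).
  have : `|k * P0 + sg * P1| <= 2 * (C * r).
    apply: (le_trans (ler_normD _ _)).
    rewrite (normrM k) (normrM sg) (gtr0_norm k0) (ger0_norm sg0).
    have : k * `|P0| <= C * r.
      apply: (@le_trans _ _ `|P0|); first by rewrite ler_piMl//; lra.
      exact: (le_trans b0).
    have : sg * `|P1| <= C * r by apply: le_trans Csr2; exact: ler_wpM2l.
    by lra.
  move=> hb; apply: (@le_trans _ _ (e^-1 * (2 * (C * r)))).
    by apply: ler_pM => //; exact: ltW.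
  by lra.
- apply: (key _ (P1 * (2 * x / (9 * s)))) => //.
  rewrite normrM; apply: (@le_trans _ _ (C * r ^+ 2 * ((1 + e^-1) * (1 + sg)))).
    apply: ler_pM => //; rewrite ler_norml.
    have -> : 2 * x / (9 * s) = s^-1 * (2 / 9 * x) by field; rewrite gt_eqF.
    set u := s^-1 * _.
    have u2 : u ^+ 2 = 4 / 9 * s^-1 * sg.
      by rewrite /u exprMn exprMn xs; field; rewrite gt_eqF.
    have u3 : u ^+ 2 <= 4 / 9 * (e^-1 * sg).
      by rewrite u2 -mulrA ler_wpM2l//; exact: ler_wpM2r.
    have esg : 0 <= e^-1 * sg by rewrite mulr_ge0// ltW.
    by apply/andP; split; nra.
  have -> : C * r ^+ 2 * ((1 + e^-1) * (1 + sg)) = C * (1 + e^-1) * r * ((1 + sg) * r) by ring.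
  by rewrite r1 mulr1; lra.
- apply: (key _ (P1 * (2 / (9 * s)) + P2 * (2 * x / (9 * s)) ^+ 2)) => //.
  have -> : P1 * (2 / (9 * s)) + P2 * (2 * x / (9 * s)) ^+ 2 =
      s^-1 * (2 / 9 * P1 + 4 / 9 * (sg * P2)).
    by rewrite !exprMn exprVn exprMn xs; field; rewrite gt_eqF.
  rewrite normrM (gtr0_norm is0).
  have hb : `|2 / 9 * P1 + 4 / 9 * (sg * P2)| <= 2 * (C * r).
    apply: (le_trans (ler_normD _ _)).
    have n2 : `|2 / 9 : R| = 2 / 9 by rewrite ger0_norm.
    have n4 : `|4 / 9 : R| = 4 / 9 by rewrite ger0_norm.
    rewrite (normrM (2 / 9)) (normrM (4 / 9)) (normrM sg) n2 n4 (ger0_norm sg0).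
    have : sg * `|P2| <= C * r by apply: le_trans Csr2; exact: ler_wpM2l.
    have : `|P1| <= C * r by exact: (le_trans b1).
    by lra.
  apply: (@le_trans _ _ (e^-1 * (2 * (C * r)))).
    by apply: ler_pM => //; exact: ltW.
  by lra.
Qed.

End self_similar_solution.

(** * Exponents below 3/2 *)

Section spreading.
Variable R : realType.

Lemma measurable_prof_coef (k : R) : 0 < k -> k <= 4^-1 ->
  measurable_fun (setT : set (measurableTypeR R)) (prof_coef k).
Proof.
move=> k0 k4; apply: measurable_fun_ifT.
- exact: measurable_fun_ler.
- apply: continuous_measurable_fun => s.
  apply: cvgM; last exact: cvg_cst.
  by apply: cvgB; [exact: cvg_cst|apply: cvgM; [exact: cvg_cst|exact: cvg_id]].
- apply: continuous_measurable_fun => s.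
  have cq : {for s, continuous (@Num.sqrt R)} by exact: sqrt_continuous.
  have q0 := sqrtr_ge0 s.
  apply: cvgM.
    by apply: cvgD; [exact: cvg_cst|apply: cvgM; [exact: cvg_cst|exact: cq]].
  apply: cvgV; last first.
    apply: cvgM; first exact: cvg_cst.
    apply: cvgD; first exact: cvg_cst.
    by apply: cvgM; [exact: cvg_cst|apply: cvgB; [exact: cq|exact: cvg_cst]].
  rewrite gt_eqF// mulr_gt0 ?mulr_gt0 ?exprn_gt0//.
  have : 0 <= k * Num.sqrt s by rewrite mulr_ge0// ltW.
  by lra.
Qed.

Definition selfsim_coef (k : R) (z : R * R) : R := 9 * prof_coef k (selfsim_var z).

Lemma selfsim_coef_class (k : R) : 0 < k -> k <= 4^-1 ->
  coef_class 1 (9 * (4 * k ^+ 2)^-1) (selfsim_coef k).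
Proof.
move=> k0 k4; split.
  have m1 : measurable_fun (@Q R : set (borel_plane R)) (@selfsim_var R).
    apply: open_continuous_plane_measurable; first exact: open_Q.
    move=> [t x]; rewrite inE /Q/= => /andP[t0 t1].
    exact: selfsim_var_continuous.
  apply: measurable_funM => //.
  exact: (measurableT_comp (measurable_prof_coef k0 k4) m1).
move=> z /andP[t0 t1]; have := prof_coef_bound k0 k4 (selfsim_var_ge0 t0).
by rewrite /selfsim_coef => /andP[a1 a2]; apply/andP; split; lra.
Qed.

(** Switched on while e < t < 2 e and off while 1 < t < 2; the second part only
    serves to bring the extension to the plane into L_p. *)
Definition window (e t : R) : R := smoothstep (e^-1 * t + - 1) * smoothstep (- 1 * t + 2).
Definition dwindow (e t : R) : R :=
  dsmoothstep (e^-1 * t + - 1) * e^-1 * smoothstep (- 1 * t + 2) +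
  smoothstep (e^-1 * t + - 1) * (dsmoothstep (- 1 * t + 2) * -1).

Lemma C1fun_window (e : R) : C1fun (window e) (dwindow e).
Proof.
exact: (C1funM (C1fun_comp (C1fun_smoothstep R) (C1fun_affine e^-1 (- 1)))
  (C1fun_comp (C1fun_smoothstep R) (C1fun_affine (- 1) 2))).
Qed.

Lemma window_out (e t : R) : 0 < e -> ~ (e <= t <= 2) ->
  window e t = 0 /\ dwindow e t = 0.
Proof.
move=> e0 /negP; rewrite negb_and -!ltNge => /orP[te|t2]; rewrite /window /dwindow.
  have h : e^-1 * t + - 1 <= 0 by rewrite subr_le0 mulrC ler_pdivrMr// mul1r ltW.
  by have [-> ->] := smoothstep_le0 h; rewrite !mul0r addr0.
have h : - 1 * t + 2 <= 0 by lra.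
by have [-> ->] := smoothstep_le0 h; rewrite !mul0r !mulr0 addr0.
Qed.

Lemma window_in (e t : R) : 0 < e -> 2 * e <= t <= 1 ->
  window e t = 1 /\ dwindow e t = 0.
Proof.
move=> e0 /andP[et t1]; rewrite /window /dwindow.
have h1 : 1 <= e^-1 * t + - 1.
  have : 2 <= e^-1 * t by rewrite mulrC ler_pdivlMr.
  by lra.
have h2 : 1 <= - 1 * t + 2 by lra.
have [-> ->] := smoothstep_ge1 h1; have [-> ->] := smoothstep_ge1 h2.
by rewrite !mul0r mul1r mulr0 addr0.
Qed.

Lemma window_bound (e t : R) : 0 < e ->
  `|window e t| <= 1 /\ `|dwindow e t| <= 2 * e^-1 + 2.
Proof.
move=> e0; rewrite /window /dwindow.
have [/andP[a0 a1] /andP[b0 b1]] := smoothstep_bound (e^-1 * t + - 1).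
have [/andP[c0 c1] /andP[d0 d1]] := smoothstep_bound (- 1 * t + 2).
have ie : 0 < e^-1 by rewrite invr_gt0.
split; rewrite ler_norml; apply/andP; split.
- by have := mulr_ge0 a0 c0; lra.
- by apply: (@le_trans _ _ (1 * 1)); [exact: ler_pM|rewrite mulr1].
- have h1 : 0 <= dsmoothstep (e^-1 * t + -1) * e^-1 * smoothstep (- 1 * t + 2).
    by rewrite !mulr_ge0// ltW.
  have : smoothstep (e^-1 * t + - 1) * dsmoothstep (- 1 * t + 2) <= 1 * 2 by exact: ler_pM.
  by rewrite mulrN1 mulrN; lra.
- have h1 : dsmoothstep (e^-1 * t + -1) * e^-1 * smoothstep (- 1 * t + 2) <= 2 * e^-1 * 1.
    by apply: ler_pM => //; [rewrite mulr_ge0// ltW|apply: ler_pM => //; exact: ltW].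
  have : 0 <= smoothstep (e^-1 * t + - 1) * dsmoothstep (- 1 * t + 2) by exact: mulr_ge0.
  by rewrite mulrN1 mulrN; lra.
Qed.

Lemma dwindow_bound (e t : R) : 0 < e -> t <= 1 -> `|dwindow e t| <= 2 * e^-1.
Proof.
move=> e0 t1; rewrite /dwindow.
have h2 : 1 <= - 1 * t + 2 by lra.
have [-> ->] := smoothstep_ge1 h2.
have [_ /andP[b0 b1]] := smoothstep_bound (e^-1 * t + - 1).
have ie : 0 <= e^-1 by rewrite invr_ge0 ltW.
rewrite mulr1 mul0r mulr0 addr0 ger0_norm ?mulr_ge0//.
exact: ler_wpM2r.
Qed.

Section truncated.
Variables (k e : R).

Definition spread_sol (z : R * R) : R :=
  window e z.1 * 1 * selfsim k (floortime e z.1, z.2).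
Definition spread_sol_t (z : R * R) : R :=
  1 * (dwindow e z.1 * selfsim k (floortime e z.1, z.2) +
       window e z.1 * dfloortime e z.1 * selfsim_t k (floortime e z.1, z.2)).
Definition spread_sol_x (z : R * R) : R :=
  window e z.1 * (0 * selfsim k (floortime e z.1, z.2) +
                  1 * selfsim_x k (floortime e z.1, z.2)).
Definition spread_sol_xx (z : R * R) : R :=
  window e z.1 * (0 * selfsim k (floortime e z.1, z.2) +
    2 * 0 * selfsim_x k (floortime e z.1, z.2) +
    1 * selfsim_xx k (floortime e z.1, z.2)).

Lemma spread_sol_C12 : 0 < e -> C12 spread_sol spread_sol_t spread_sol_x spread_sol_xx.
Proof.
move=> e0.
apply: (C12_product (C1fun_window e) (C1fun_cst 1) (C1fun_cst 0) (C1fun_floortime e)).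
  by move=> t; apply: lt_le_trans (floortime_ge t e0); rewrite divr_gt0.
exact: selfsim_half_C12.
Qed.

Lemma spread_sol_out (t x : R) : 0 < e -> ~ (e <= t <= 2) ->
  [/\ spread_sol (t, x) = 0, spread_sol_t (t, x) = 0,
      spread_sol_x (t, x) = 0 & spread_sol_xx (t, x) = 0].
Proof.
move=> e0 /(window_out e0) [w0 dw0].
rewrite /spread_sol /spread_sol_t /spread_sol_x /spread_sol_xx/= w0 dw0.
by rewrite !(mul0r, mulr0, addr0).
Qed.

Lemma spread_sol_in (t x : R) : e <= t ->
  [/\ spread_sol (t, x) = window e t * selfsim k (t, x),
      spread_sol_t (t, x) = dwindow e t * selfsim k (t, x) + window e t * selfsim_t k (t, x),
      spread_sol_x (t, x) = window e t * selfsim_x k (t, x) &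
      spread_sol_xx (t, x) = window e t * selfsim_xx k (t, x)].
Proof.
move=> et; have [f1 f2] := floortime_id et.
rewrite /spread_sol /spread_sol_t /spread_sol_x /spread_sol_xx/= f1 f2.
by rewrite !(mulr1, mul1r, mul0r, mulr0, add0r).
Qed.

Lemma spread_sol_decay : 0 < k -> k <= 4^-1 -> 0 < e ->
  [/\ strip_decay spread_sol, strip_decay spread_sol_t, strip_decay spread_sol_x &
      strip_decay spread_sol_xx].
Proof.
move=> k0 k4 e0; have [D D0 HD] := selfsim_decay k0 k4 e0.
have ie : 0 < e^-1 by rewrite invr_gt0.
pose E := (2 * e^-1 + 3) * D.
have E0 : 0 <= E by rewrite mulr_ge0 ?ltW//; lra.
have red (f : R * R -> R) :
    (forall t x, ~ (e <= t <= 2) -> f (t, x) = 0) ->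
    (forall t x, e <= t <= 2 -> `|f (t, x)| <= E * cauchy_weight 1 x) ->
    strip_decay f.
  move=> f0 f1; exists E, 2; split => // t x.
  have [et|et] := pselect (e <= t <= 2).
    rewrite indicE mem_set ?mul1r; first exact: f1.
    by case/andP: et => et t2; rewrite /= in_itv/= t2 andbT (le_trans _ et)// ltW.
  rewrite f0// normr0 mulr_ge0// mulr_ge0//.
  by have /andP[] := cauchy_weight01 1 x.
have wbd (w s : R) x : `|w| <= 1 -> `|s| <= D * cauchy_weight 1 x ->
    `|w * s| <= E * cauchy_weight 1 x.
  have /andP[c0 _] := cauchy_weight01 1 x.
  have Dc : 0 <= D * cauchy_weight 1 x by rewrite mulr_ge0// ltW.
  have eDc : 0 <= e^-1 * (D * cauchy_weight 1 x) by rewrite mulr_ge0// ltW.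
  move=> w1 sD; rewrite normrM; apply: (@le_trans _ _ (1 * (D * cauchy_weight 1 x))).
    exact: ler_pM.
  by rewrite /E; lra.
split; apply: red => t x.
- by case/(spread_sol_out x e0).
- move=> tt; have /andP[et _] := tt; have [-> _ _ _] := spread_sol_in x et.
  by have [h _ _ _] := HD _ x tt; apply: wbd => //; have [] := window_bound t e0.
- by case/(spread_sol_out x e0).
- move=> tt; have /andP[et _] := tt; have [_ -> _ _] := spread_sol_in x et.
  have [h ht _ _] := HD _ x tt; have [w1 dw1] := window_bound t e0.
  have /andP[c0 _] := cauchy_weight01 1 x.
  have Dc : 0 <= D * cauchy_weight 1 x by rewrite mulr_ge0// ltW.
  apply: (le_trans (ler_normD _ _)); rewrite (normrM (window _ _)) (normrM (dwindow _ _)).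
  have := ler_pM (normr_ge0 _) (normr_ge0 _) dw1 h.
  have := ler_pM (normr_ge0 _) (normr_ge0 _) w1 ht.
  by rewrite /E; lra.
- by case/(spread_sol_out x e0).
- move=> tt; have /andP[et _] := tt; have [_ _ -> _] := spread_sol_in x et.
  by have [_ _ h _] := HD _ x tt; apply: wbd => //; have [] := window_bound t e0.
- by case/(spread_sol_out x e0).
- move=> tt; have /andP[et _] := tt; have [_ _ _ ->] := spread_sol_in x et.
  by have [_ _ _ h] := HD _ x tt; apply: wbd => //; have [] := window_bound t e0.
Qed.

Lemma spread_sol_W12 (p : R) : 1 <= p -> 0 < k -> k <= 4^-1 -> 0 < e -> W12_0 p spread_sol.
Proof.
move=> p1 k0 k4 e0; have [d1 d2 d3 d4] := spread_sol_decay k0 k4 e0.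
apply: (W12_0_intro p1 (spread_sol_C12 e0)) => //.
move=> [t x]/= t0; have [|//] := @spread_sol_out t x e0.
by move=> /andP[et _]; have := le_trans et t0; rewrite leNgt e0.
Qed.

(** The self-similar function solves the equation exactly, so that only the
    term with the derivative of the window remains; it lives in t < 2 e, has
    size e^(-1-k), and there the profile is concentrated at |x| of order
    sqrt e. *)
Lemma spread_sol_rhs (C : R) : 0 < k -> 0 < e -> 0 < C ->
  (forall s, 0 <= s -> `|prof k s| <= C / (1 + s) ^+ 2) ->
  forall t x, 0 < t < 1 ->
  `|spread_sol_t (t, x) - (1 * selfsim_coef k (t, x) + 1 - 1) * spread_sol_xx (t, x)| <=
  2 * e^-1 * e `^ (- k) * C *
  (\1_(`[0, 2 * e]%classic) t * cauchy_weight (Num.sqrt (18 * e)) x).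
Proof.
move=> k0 e0 C0 HC t x /andP[t0 t1].
have ie : 0 <= e^-1 by rewrite invr_ge0 ltW.
have /andP[c0 _] := cauchy_weight01 (Num.sqrt (18 * e)) x.
have ind0 : 0 <= \1_(`[0, 2 * e]%classic) t :> R.
  by rewrite indicE; case: (_ \in _).
have rhs0 : 0 <= 2 * e^-1 * e `^ (- k) * C *
    (\1_(`[0, 2 * e]%classic) t * cauchy_weight (Num.sqrt (18 * e)) x).
  by rewrite !mulr_ge0 ?powR_ge0// ltW.
have [et|te] := leP e t; last first.
  have [|_ -> _ ->] := @spread_sol_out t x e0; last by rewrite mulr0 subrr normr0.
  by rewrite leNgt te.
have [_ -> _ ->] := spread_sol_in x et.
rewrite (@selfsim_eq _ _ (t, x))// -/(selfsim_coef k (t, x)) mul1r addrK.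
have -> : dwindow e t * selfsim k (t, x) +
    window e t * (selfsim_coef k (t, x) * selfsim_xx k (t, x)) -
    selfsim_coef k (t, x) * (window e t * selfsim_xx k (t, x)) =
    dwindow e t * selfsim k (t, x) by ring.
have [t2|t2] := leP (2 * e) t.
  have [|_ ->] := @window_in e t e0; first by rewrite t2 ltW.
  by rewrite mul0r normr0.
rewrite indicE mem_set/= ?in_itv/= ?(ltW t0) ?(ltW t2)// mul1r.
rewrite normrM -!mulrA mulrA; apply: ler_pM => //.
  exact: (dwindow_bound e0 (ltW t1)).
rewrite /selfsim/= normrM (ger0_norm (powR_ge0 _ _)); apply: ler_pM => //.
- exact: powR_ge0.
- by apply: powR_anti => //; rewrite oppr_le0 ltW.
have sg0 := @selfsim_var_ge0 R (t, x) t0.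
apply: (le_trans (HC _ sg0)); apply: ler_wpM2l; first exact: ltW.
set sg := selfsim_var (t, x) in sg0 *.
apply: (@le_trans _ _ (1 + sg)^-1).
  rewrite lef_pV2 ?posrE; [|by rewrite exprn_gt0//; lra|by lra].
  nra.
rewrite /cauchy_weight lef_pV2 ?posrE; last 2 first.
- by lra.
- by rewrite ltr_pwDl// sqr_ge0.
rewrite lerD2l exprMn exprVn sqr_sqrtr; last by lra.
rewrite /sg /selfsim_var/=; apply: ler_wpM2l; first exact: sqr_ge0.
by rewrite lef_pV2 ?posrE; lra.
Qed.

(** The box (1/2, 3/4) x (0, 1) lies in the concave region s < 1 and past the
    switching of the window, so that the bound does not depend on e. *)
Lemma spread_sol_xx_lower (t x : R) : 0 < k -> 0 < e <= 8^-1 ->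
  2^-1 <= t <= 3 / 4 -> 0 <= x <= 1 -> k / 5 <= `|spread_sol_xx (t, x)|.
Proof.
move=> k0 /andP[e0 e8] /andP[t1 t2] /andP[x0 x1].
have et : e <= t by lra.
have [_ _ _ ->] := spread_sol_in x et.
have [|-> _] := @window_in e t e0; first by apply/andP; split; lra.
have t0 : 0 < t by lra.
rewrite mul1r.
have sg0 := @selfsim_var_ge0 R (t, x) t0.
have sg1 : selfsim_var (t, x) <= 2 / 9.
  rewrite /selfsim_var/= ler_pdivrMr ?mulr_gt0//; nra.
have -> : selfsim_xx k (t, x) =
    - (t `^ (- k) * (t^-1 * (2 / 9 * (3 / 2 * k * (1 - selfsim_var (t, x)))))).
  rewrite -mulrN -mulrN -mulrN -prof_concave ?sg0; last by lra.
  by rewrite /selfsim_xx /selfsim_var/=; field; rewrite gt_eqF.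
have tk : 1 <= t `^ (- k).
  rewrite powRN invf_ge1 ?powR_gt0//.
  have := @ger_powR _ t _ 0 k (ltW k0); rewrite powRr0; apply.
  by rewrite t0; lra.
have it : 1 <= t^-1 by rewrite invf_ge1//; lra.
set c := 2 / 9 * _.
have c1 : k / 5 <= c by rewrite /c; nra.
have k5 : 0 <= k / 5 by lra.
have c0 : 0 <= c by lra.
rewrite normrN ger0_norm; last by rewrite !mulr_ge0//; lra.
apply: (le_trans c1); apply: (@le_trans _ _ (t^-1 * c)); first exact: ler_peMl.
by apply: ler_peMl => //; rewrite mulr_ge0//; lra.
Qed.

End truncated.

(** The right-hand side has L_p norm of order e^(3/(2p) - 1 - k): the height
    e^(-1-k) on a set of measure of order e^(3/2). The exponent is positive for
    small k exactly because p < 3/2, while u_xx stays bounded below. *)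
Lemma estimate_fails_lt32 (p : R) (hp : 1 < p < 3 / 2) :
  exists (alpha : R) (a : R * R -> R),
    [/\ 1 < alpha, coef_class 1 alpha a & estimate_fails p a].
Proof.
case/andP: hp => p1 p32; have p0 : 0 < p by lra.
(* At most half of the admissible decay rate 3/(2p) - 1, so that eta is positive. *)
pose k := Num.min 4^-1 ((3 / (2 * p) - 1) / 2).
have q0 : 0 < 3 / (2 * p) - 1.
  by rewrite subr_gt0 ltr_pdivlMr ?mul1r//; lra.
have k0 : 0 < k by rewrite lt_min; apply/andP; split; lra.
have k4 : k <= 4^-1 by rewrite ge_min lexx.
have kq : k <= (3 / (2 * p) - 1) / 2 by rewrite ge_min lexx orbT.
pose eta := 3 / (2 * p) - 1 - k.
have eta0 : 0 < eta by rewrite /eta; lra.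
exists (9 * (4 * k ^+ 2)^-1), (selfsim_coef k); split.
- have : 1 <= (4 * k ^+ 2)^-1.
    by rewrite invf_ge1 ?mulr_gt0 ?exprn_gt0//; nra.
  by lra.
- exact: selfsim_coef_class.
move=> N N0; have [C C0 HC] := prof_decay k0 k4.
pose K : R := (2 * (pi * Num.sqrt 18)) `^ p^-1.
pose d := k / 5 * ((3 / 4 - 2^-1) * (1 - 0)) `^ p^-1.
have d0 : 0 < d.
  rewrite /d mulr_gt0 ?powR_gt0//; lra.
have K0 : 0 <= K by exact: powR_ge0.
have B0 : 0 <= N * (2 * C * K) by rewrite !mulr_ge0// ltW.
have [e e8 small] := small_powR eta0 B0 d0.
have e0 : 0 < e by case/andP: e8.
have HU := spread_sol_C12 k e0.
exists (spread_sol k e), (spread_sol_t k e), (spread_sol_xx k e), 1; split.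
- by apply: spread_sol_W12 => //; exact: ltW.
- by rewrite ler01 lexx.
- exact: C12_dt_Q HU.
- exact: C12_dxx_Q HU.
have [mt mxx] := C12_measurable_Q HU.
have s18 : 0 < Num.sqrt (18 * e) by rewrite sqrtr_gt0 mulr_gt0.
apply: (@LpQ_norm_gap _ p _ _ (cauchy_weight (Num.sqrt (18 * e)))
  (2 * e^-1 * e `^ (- k) * C) (2 * e) (pi * Num.sqrt (18 * e)) (k / 5)
  2^-1 (3 / 4) 0 1 N) => //.
- exact: ltW.
- by rewrite !mulr_ge0 ?powR_ge0 ?invr_ge0// ltW.
- by rewrite mulr_ge0// ltW.
- by rewrite mulr_ge0 ?pi_ge0// ltW.
- by lra.
- by lra.
- by lra.
- exact: ltW.
- exact: (measurable_rhs _ (selfsim_coef_class k0 k4)).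
- by apply: continuous_measurable_fun; exact: cauchy_weight_continuous.
- exact: cauchy_weight01.
- exact: integral_cauchy_weight.
- by apply: (spread_sol_rhs k0 e0 C0) => s /HC[].
- by move=> t x tt xx; exact: spread_sol_xx_lower.
apply: le_lt_trans small; rewrite le_eqVlt; apply/orP; left; apply/eqP.
rewrite -!mulrA; congr (_ * _).
have -> : e^-1 = e `^ (-1) by rewrite powR_inv1// ltW.
have -> : 2 * (e * (pi * Num.sqrt (18 * e))) = (2 * (pi * Num.sqrt 18)) * e `^ (3 / 2).
  rewrite sqrtrM// -[Num.sqrt e]powR12_sqrt ?(ltW e0)//.
  have -> : 3 / 2 = 1 + 2^-1 :> R by field.
  rewrite powRD; last by apply/implyP => _; rewrite gt_eqF.
  by rewrite powRr1 ?(ltW e0)//; ring.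
rewrite powRM ?mulr_ge0 ?pi_ge0 ?powR_ge0 ?sqrtr_ge0//.
rewrite -powRrM -/K.
have pw (a b : R) : e `^ (a + b) = e `^ a * e `^ b.
  by rewrite powRD//; apply/implyP => _; rewrite gt_eqF.
have -> : eta = (-1) + (- k) + 3 / 2 * p^-1.
  by rewrite /eta; field; rewrite gt_eqF.
by rewrite !pw; ring.
Qed.

End spreading.

(** * A function focusing at a point *)

Section focusing_power.
Variable R : realType.
Implicit Types z : R * R.

(** A power of a parabolic distance to the point (0, c). *)
Definition parab_pow (b c a : R) z : R := (b * z.1 + (z.2 - c) ^+ 2 / 4) `^ a.

Lemma parab_pow_base_gt0 (b c s y : R) : 0 < b -> 0 < s -> 0 < b * s + (y - c) ^+ 2 / 4.
Proof. by move=> b0 s0; rewrite ltr_wpDr ?divr_ge0 ?sqr_ge0// mulr_gt0. Qed.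

Lemma parab_pow_t_deriv (b c a s y : R) : 0 < b -> 0 < s ->
  is_derive s 1 (fun s => parab_pow b c a (s, y)) (a * parab_pow b c (a - 1) (s, y) * b).
Proof.
move=> b0 s0; have P0 := @parab_pow_base_gt0 b c s y b0 s0.
have D1 := is_derive1_powR a P0.
have D2 := (C1fun_affine b ((y - c) ^+ 2 / 4)).2 s.
exact: (@is_derive1_comp _ (fun v => v `^ a) _ s _ _ D1 D2).
Qed.

Lemma parab_pow_x_deriv (b c a s y : R) : 0 < b -> 0 < s ->
  is_derive y 1 (fun y => parab_pow b c a (s, y))
    (a * parab_pow b c (a - 1) (s, y) * ((y - c) / 2)).
Proof.
move=> b0 s0; have P0 := @parab_pow_base_gt0 b c s y b0 s0.
have D1 := is_derive1_powR a P0.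
have D2 : is_derive y 1 (fun y => b * s + (y - c) ^+ 2 / 4) ((y - c) / 2).
  have D3 := (C1funM (C1fun_affine (4^-1) (- (4^-1 * c))) (C1fun_affine 1 (- c))).2 y.
  have -> : (fun y => b * s + (y - c) ^+ 2 / 4) =
      (fun y => b * s + (4^-1 * y + - (4^-1 * c)) * (1 * y + - c)).
    by apply/funext => w; field.
  by apply: is_derive_eq; field.
exact: (@is_derive1_comp _ (fun v => v `^ a) _ y _ _ D1 D2).
Qed.

Lemma parab_pow_continuous (b c a s y : R) : 0 < b -> 0 < s ->
  {for (s, y), continuous (parab_pow b c a)}.
Proof.
move=> b0 s0; have P0 := @parab_pow_base_gt0 b c s y b0 s0.
apply: (@continuous_comp _ _ _ (fun z => b * z.1 + (z.2 - c) ^+ 2 / 4)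
  (fun v : R => v `^ a)).
  apply: cvgD; first by apply: cvgM; [exact: cvg_cst|exact: cvg_fst].
  apply: cvgM; last exact: cvg_cst.
  by apply: cvgM; apply: cvgB; (exact: cvg_snd || exact: cvg_cst).
apply: differentiable_continuous; apply/derivable1_diffP.
by case: (is_derive1_powR a P0).
Qed.

Section focusing_profile.
Variables (g b K c : R).

(** In the backward time s the first term, a power g > 1/2 of the squared
    parabolic distance, is convex in x, but increases in s whereas u_t = a u_xx
    requires a decrease. The second term provides the decrease, and a large b in it
    keeps its effect on the convexity small. *)
Definition focus z : R := parab_pow 1 c g z - K * z.1 * parab_pow b c (g - 1) z.
Definition focus_t z : R :=
  g * parab_pow 1 c (g - 1) z -
  K * (parab_pow b c (g - 1) z + z.1 * ((g - 1) * parab_pow b c (g - 1 - 1) z * b)).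
Definition focus_x z : R :=
  (z.2 - c) / 2 * (g * parab_pow 1 c (g - 1) z -
                   K * z.1 * ((g - 1) * parab_pow b c (g - 1 - 1) z)).
Definition focus_xx z : R :=
  2^-1 * (g * parab_pow 1 c (g - 1) z - K * z.1 * ((g - 1) * parab_pow b c (g - 1 - 1) z)) +
  ((z.2 - c) / 2) ^+ 2 *
  (g * ((g - 1) * parab_pow 1 c (g - 1 - 1) z) -
   K * z.1 * ((g - 1) * ((g - 1 - 1) * parab_pow b c (g - 1 - 1 - 1) z))).

Lemma focus_half_C12 : 0 < b -> half_C12 focus focus_t focus_x focus_xx.
Proof.
move=> b0 s y s0.
have T1 (a : R) := @parab_pow_t_deriv 1 c a s y ltr01 s0.
have Tb (a : R) := @parab_pow_t_deriv b c a s y b0 s0.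
have X1 (a : R) := @parab_pow_x_deriv 1 c a s y ltr01 s0.
have Xb (a : R) := @parab_pow_x_deriv b c a s y b0 s0.
have c1 (a : R) := @parab_pow_continuous 1 c a s y ltr01 s0.
have cb (a : R) := @parab_pow_continuous b c a s y b0 s0.
have cf : {for (s, y), continuous (fun z : R * R => z.1)} by exact: cvg_fst.
have cy : {for (s, y), continuous (fun z : R * R => (z.2 - c) / 2)}.
  by apply: cvgM; [apply: cvgB; [exact: cvg_snd|exact: cvg_cst]|exact: cvg_cst].
have cK : {for (s, y), continuous (fun z : R * R => K * z.1)}.
  by apply: cvgM; [exact: cvg_cst|exact: cf].
have cZ (k : R) (f : R * R -> R) : {for (s, y), continuous f} ->
    {for (s, y), continuous (fun z => k * f z)}.
  by move=> h; apply: cvgM; [exact: cvg_cst|exact: h].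
have cmain : {for (s, y), continuous (fun z => g * parab_pow 1 c (g - 1) z -
    K * z.1 * ((g - 1) * parab_pow b c (g - 1 - 1) z))}.
  apply: cvgB; first exact: (cZ _ _ (c1 _)).
  by apply: cvgM; [exact: cK|exact: (cZ _ _ (cb _))].
have Dy : is_derive y 1 (fun y => (y - c) / 2) 2^-1.
  have -> : (fun y => (y - c) / 2) = (fun y => 2^-1 * y + - (c / 2)).
    by apply/funext => w; field.
  exact: (C1fun_affine 2^-1 (- (c / 2))).2.
split; split.
- rewrite /focus /focus_t/=; have h1 := T1 g; have h2 := Tb (g - 1).
  by apply: is_derive_eq; rewrite /GRing.scale/=; ring.
- rewrite /focus /focus_x/=; have h1 := X1 g; have h2 := Xb (g - 1).
  by apply: is_derive_eq; rewrite /GRing.scale/=; field.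
- rewrite /focus_x /focus_xx/=; have h1 := X1 (g - 1); have h2 := Xb (g - 1 - 1).
  by apply: is_derive_eq; rewrite /GRing.scale/=; field.
- apply: cvgB; first exact: c1.
  by apply: cvgM; [exact: cK|exact: cb].
- apply: cvgB; first exact: (cZ _ _ (c1 _)).
  apply: (cZ K); apply: cvgD; first exact: cb.
  apply: cvgM; first exact: cf.
  by apply: cvgM; [exact: (cZ _ _ (cb _))|exact: cvg_cst].
- by apply: cvgM; [exact: cy|exact: cmain].
- apply: cvgD; first exact: (cZ _ _ cmain).
  apply: cvgM; first by apply: cvgM; exact: cy.
  apply: cvgB; first by apply: (cZ g); exact: (cZ _ _ (c1 _)).
  apply: cvgM; first exact: cK.
  by apply: (cZ (g - 1)); exact: (cZ _ _ (cb _)).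
Qed.

End focusing_profile.

End focusing_power.

(** * Size of the focusing function and of its derivatives *)

Section focusing_bounds.
Variable R : realType.

(** All terms are multiples of A and B by factors th, si, pp in [0, 1].
    The choice of b gives K B >= 2 A, because S <= b P; hence the decrease due to
    the second term beats the increase due to the first one. In focus_xx the
    second term enters only with K / b = g (2 g - 1) / 3 instead of K, which is
    too small to destroy the convexity g (2 g - 1) A / 2 of the first term. *)
Lemma focus_bounds (g b c s y : R) : 2^-1 < g < 1 ->
  b `^ g = 6 / (g * (2 * g - 1)) -> 1 <= b -> 0 < s ->
  let K := b * (g * (2 * g - 1) / 3) in
  let A := parab_pow 1 c (g - 1) (s, y) in
  [/\ 0 < A, g * A <= - focus_t g b K c (s, y) <= K * A &
      g * (2 * g - 1) / 4 * A <= focus_xx g b K c (s, y) <= g * A].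
Proof.
move=> /andP[g2 g1] bg b1 s0 K A.
have b0 : 0 < b by rewrite (lt_le_trans _ b1).
have P0 := @parab_pow_base_gt0 _ 1 c s y ltr01 s0.
have S0 := @parab_pow_base_gt0 _ b c s y b0 s0.
pose q := (y - c) ^+ 2 / 4.
have q0 : 0 <= q by rewrite divr_ge0// sqr_ge0.
rewrite mul1r -/q in P0; rewrite -/q in S0.
pose P := s + q; pose S := b * s + q; rewrite -/P in P0; rewrite -/S in S0.
pose B := parab_pow b c (g - 1) (s, y).
have AE : A = P `^ (g - 1) by rewrite /A /parab_pow/= mul1r.
have BE : B = S `^ (g - 1) by [].
have A0 : 0 < A by rewrite AE powR_gt0.
have B0 : 0 < B by rewrite BE powR_gt0.
have A2E : parab_pow 1 c (g - 1 - 1) (s, y) = A / P.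
  by rewrite AE /parab_pow/= mul1r -/q -/P (powR_subr1 (g - 1) P0).
have B2E : parab_pow b c (g - 1 - 1) (s, y) = B / S.
  by rewrite BE /parab_pow/= -/q -/S (powR_subr1 (g - 1) S0).
have B3E : parab_pow b c (g - 1 - 1 - 1) (s, y) = B / S / S.
  by rewrite BE /parab_pow/= -/q -/S (powR_subr1 (g - 1 - 1) S0) (powR_subr1 (g - 1) S0).
have PS : P <= S by rewrite lerD2r ler_peMl// ltW.
have SbP : S <= b * P by rewrite mulrDr lerD2l ler_peMl.
have BA : B <= A by rewrite AE BE; apply: powR_anti => //; lra.
have e0 : 0 < 2 * g - 1 by lra.
have ge0 : 0 < g * (2 * g - 1) by rewrite mulr_gt0//; lra.
have KB : 2 * A <= K * B.
  have : (b * P) `^ (g - 1) <= B by rewrite BE; apply: powR_anti => //; lra.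
  rewrite powRM ?(ltW b0) ?(ltW P0)// -AE powR_subr1// bg => h.
  have -> : 2 * A = K * (6 / (g * (2 * g - 1)) / b * A).
    by rewrite /K; field; rewrite !gt_eqF//; lra.
  by apply: ler_wpM2l => //; rewrite /K mulr_ge0 ?divr_ge0 ?ltW.
set G := g * (2 * g - 1) in ge0 K KB *.
have G1 : G <= g by rewrite /G; nra.
have K0 : 0 < K by rewrite /K mulr_gt0 ?divr_gt0.
pose th := b * s / S; pose si := q / S; pose pp := q / P.
have th0 : 0 <= th by rewrite divr_ge0 ?mulr_ge0// ltW.
have th1 : th <= 1 by rewrite ler_pdivrMr// mul1r /S lerDl.
have si0 : 0 <= si by rewrite divr_ge0// ltW.
have si1 : si <= 1 by rewrite ler_pdivrMr// mul1r /S lerDr mulr_ge0// ltW.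
have pp0 : 0 <= pp by rewrite divr_ge0// ltW.
have pp1 : pp <= 1 by rewrite ler_pdivrMr// mul1r /P lerDr ltW.
have tE : - focus_t g b K c (s, y) = K * B - g * A - (1 - g) * (K * B * th).
  rewrite /focus_t B2E -/A -/B /th/=; field; rewrite gt_eqF//.
have xE : focus_xx g b K c (s, y) = 2^-1 * (g * A) + 2^-1 * ((1 - g) * (G / 3 * B * th))
    - (1 - g) * (g * A * pp) - (1 - g) * (2 - g) * (G / 3 * B * th * si).
  rewrite /focus_xx A2E B2E B3E -/A -/B /th /si /pp/=.
  have -> : ((y - c) / 2) ^+ 2 = q by rewrite /q; field.
  rewrite /K; field; rewrite !gt_eqF//.
have KBp : 0 <= K * B by rewrite mulr_ge0 ?ltW.
have KBA : K * B <= K * A by rewrite ler_wpM2l// ltW.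
have gA : 0 <= g * A by rewrite mulr_ge0 ?ltW//; lra.
have KBth0 : 0 <= K * B * th by rewrite mulr_ge0.
have KBth1 : K * B * th <= K * B by rewrite ler_piMr.
have G3 : 0 <= G / 3 by lra.
have GB0 : 0 <= G / 3 * B by exact: mulr_ge0 G3 (ltW B0).
have GBth0 : 0 <= G / 3 * B * th by exact: mulr_ge0.
have GBth1 : G / 3 * B * th <= G / 3 * A.
  apply: (@le_trans _ _ (G / 3 * B)); first by rewrite ler_piMr.
  exact: ler_wpM2l.
have GA : G * A <= g * A by rewrite ler_wpM2r// ltW.
have GA0 : 0 <= G * A by exact: mulr_ge0 (ltW ge0) (ltW A0).
have gApp1 : g * A * pp <= g * A by rewrite ler_piMr.
have gApp0 : 0 <= g * A * pp by rewrite mulr_ge0.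
split => //.
  rewrite tE; apply/andP; split.
    have : (1 - g) * (K * B * th) <= (1 - g) * (K * B) by apply: ler_wpM2l => //; lra.
    have : g * (2 * A) <= g * (K * B) by apply: ler_wpM2l => //; lra.
    by lra.
  have : 0 <= (1 - g) * (K * B * th) by apply: mulr_ge0 => //; lra.
  by lra.
rewrite xE; set X := G / 3 * B * th in GBth0 GBth1 *.
have Xsi0 : 0 <= X * si by exact: mulr_ge0.
have Xsi1 : X * si <= X by rewrite ler_piMr.
apply/andP; split.
  have h1 : (1 - g) * (g * A * pp) <= (1 - g) * (g * A) by apply: ler_wpM2l => //; lra.
  have h2 : (1 - g) * (2 - g) * (X * si) <= (1 - g) * (2 - g) * X.
    by apply: ler_wpM2l => //; nra.
  have h3 : (1 - g) * ((2 - g) - 2^-1) * X <= 2^-1 * X.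
    by apply: ler_wpM2r => //; nra.
  have h4 : g * A - 2 * ((1 - g) * (g * A)) = G * A by rewrite /G; ring.
  by lra.
have h1 : 0 <= (1 - g) * (g * A * pp) by apply: mulr_ge0 => //; lra.
have h2 : 0 <= (1 - g) * (2 - g) * (X * si) by apply: mulr_ge0 => //; nra.
have h3 : (1 - g) * X <= 2^-1 * X by apply: ler_wpM2r => //; lra.
by lra.
Qed.

(** The function and its first derivative in x stay bounded near the singular
    point, the latter because g >= 1/2: the product y P^(g-1) is bounded by a
    multiple of P^(g-1/2). Cutoffs only produce terms with these two quantities. *)
Lemma focus_size (g b K c s y : R) : 2^-1 < g < 1 -> 1 <= b -> 0 <= K ->
  0 < s <= 2 -> `|y - c| <= 1 ->
  `|focus g b K c (s, y)| <= 3 * (1 + K) /\ `|focus_x g b K c (s, y)| <= 3 * (1 + K).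
Proof.
move=> /andP[g2 g1] b1 K0 /andP[s0 s2] yc.
have b0 : 0 < b by rewrite (lt_le_trans _ b1).
have P0 := @parab_pow_base_gt0 _ 1 c s y ltr01 s0.
have S0 := @parab_pow_base_gt0 _ b c s y b0 s0.
pose q := (y - c) ^+ 2 / 4.
have q0 : 0 <= q by rewrite divr_ge0// sqr_ge0.
have yc2 : (y - c) ^+ 2 <= 1 by rewrite -real_normK ?num_real// expr_le1.
have q1 : q <= 4^-1 by rewrite /q; lra.
rewrite mul1r -/q in P0; rewrite -/q in S0.
pose P := s + q; pose S := b * s + q; rewrite -/P in P0; rewrite -/S in S0.
pose A := P `^ (g - 1); pose B := S `^ (g - 1).
have A0 : 0 < A by rewrite powR_gt0.
have B0 : 0 < B by rewrite powR_gt0.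
have PS : P <= S by rewrite lerD2r ler_peMl// ltW.
have BA : B <= A by apply: powR_anti => //; lra.
have P3 : P <= 3 by rewrite /P; lra.
have powP (a : R) : 0 <= a <= 1 -> P `^ a <= 3.
  move=> /andP[a0 a1]; apply: (@le_trans _ _ (3 `^ a)).
    by apply: ge0_ler_powR; rewrite ?nnegrE// ltW.
  by apply: ler1_powR => //; lra.
have PA : P * A = P `^ g by rewrite /A powR_subr1// mulrCA divff ?mulr1// gt_eqF.
have PA3 : P * A <= 3 by rewrite PA; apply: powP; apply/andP; split; lra.
have PAA : P * A ^+ 2 <= 3.
  have -> : P * A ^+ 2 = P `^ (2 * g - 1).
    have -> : 2 * g - 1 = g + (g - 1) by ring.
    rewrite powRD; last by rewrite (gt_eqF P0) implybT.
    by rewrite -PA -/A expr2 mulrA.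
  by apply: powP; apply/andP; split; lra.
have sB : s * B <= P * A.
  by apply: ler_pM => //; [exact: ltW|exact: ltW|rewrite /P lerDl].
have sB0 : 0 <= s * B by rewrite mulr_ge0 ?ltW.
split.
  have -> : focus g b K c (s, y) = P * A - K * (s * B).
    by rewrite /focus /parab_pow/= mul1r -/q -/P -/S -/B PA mulrA.
  have h1 : K * (s * B) <= K * 3 by apply: ler_wpM2l => //; lra.
  have h2 : 0 <= K * (s * B) by exact: mulr_ge0.
  have h3 : 0 <= P * A by rewrite mulr_ge0 ?ltW.
  by rewrite ler_norml; apply/andP; split; lra.
have -> : focus_x g b K c (s, y) =
    (y - c) / 2 * (g * A + K * (1 - g) * (s / S * B)).
  rewrite /focus_x /parab_pow/= mul1r -/q -/P -/S -/A (powR_subr1 (g - 1) S0) -/B.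
  by field; rewrite gt_eqF.
have sS1 : s / S * B <= A.
  rewrite -[A]mul1r; apply: ler_pM => //; [by rewrite divr_ge0 ?ltW|exact: ltW|].
  by rewrite ler_pdivrMr// mul1r (le_trans _ PS)// /P lerDl.
have sS0 : 0 <= s / S * B by rewrite mulr_ge0 ?divr_ge0 ?ltW.
set u := s / S * B in sS1 sS0 *.
have f0 : 0 <= g * A + K * (1 - g) * u.
  have gp : 0 <= g by lra.
  have gm : 0 <= 1 - g by lra.
  exact: addr_ge0 (mulr_ge0 gp (ltW A0)) (mulr_ge0 (mulr_ge0 K0 gm) sS0).
have f1 : g * A + K * (1 - g) * u <= (1 + K) * A.
  have : g * A <= A by rewrite ler_piMl ?ltW.
  have : K * (1 - g) * u <= K * A.
    rewrite -mulrA; apply: ler_wpM2l => //.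
    by apply: (@le_trans _ _ u) => //; rewrite ler_piMl//; lra.
  by lra.
(* Compared through squares, since ((y - c) / 2)^2 = q <= P. *)
have yA : `|(y - c) / 2| * A <= 3.
  have h : (`|(y - c) / 2| * A) ^+ 2 <= 3.
    rewrite exprMn real_normK ?num_real//.
    have -> : ((y - c) / 2) ^+ 2 = q by rewrite /q; field.
    apply: le_trans PAA; apply: ler_wpM2r; first exact: sqr_ge0.
    by rewrite /P lerDr ltW.
  have w0 : 0 <= `|(y - c) / 2| * A by exact: mulr_ge0 (normr_ge0 _) (ltW A0).
  by move: (`|(y - c) / 2| * A) h w0 => w h w0; nra.
rewrite normrM (ger0_norm f0).
apply: (@le_trans _ _ (`|(y - c) / 2| * ((1 + K) * A))).
  exact: ler_wpM2l.
rewrite mulrCA [leRHS]mulrC; apply: ler_wpM2l => //; lra.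
Qed.

End focusing_bounds.

(** * Truncation of the focusing function *)

Section focusing_cutoff.
Variable R : realType.

(** Vanishes to second order at t = 0 and t = 2; on the strip it needs a lower
    bound only for t >= 1/2. *)
Definition tcut (t : R) : R := pospow 2 t * pospow 2 (-1 * t + 2).
Definition dtcut (t : R) : R :=
  2 * pospow 1 t * pospow 2 (-1 * t + 2) +
  pospow 2 t * (2 * pospow 1 (-1 * t + 2) * -1).

Lemma C1fun_tcut : C1fun tcut dtcut.
Proof.
exact: (C1funM (C1fun_pospow R 0)
  (C1fun_comp (C1fun_pospow R 0) (C1fun_affine (-1) 2))).
Qed.

Lemma tcut_out (t : R) : ~ (0 <= t <= 2) -> tcut t = 0 /\ dtcut t = 0.
Proof.
move=> /negP; rewrite negb_and -!ltNge => /orP[t0|t2]; rewrite /tcut /dtcut /pospow.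
  by rewrite (max_idPl (ltW t0)) !expr0n !(mulr0, mul0r) addr0.
have h : -1 * t + 2 <= 0 by lra.
by rewrite [Num.max 0 (_ + 2)](max_idPl h) !expr0n !(mulr0, mul0r) addr0.
Qed.

Lemma tcut_bound (t : R) : 0 < t < 1 ->
  [/\ 0 <= tcut t <= 1, `|dtcut t| <= 4 & 2^-1 <= t -> 4^-1 <= tcut t].
Proof.
move=> /andP[t0 t1]; rewrite /tcut /dtcut /pospow.
have h : 0 <= -1 * t + 2 by lra.
rewrite (max_idPr (ltW t0)) (max_idPr h) !expr1.
have -> : -1 * t + 2 = 2 - t by ring.
have E : t ^+ 2 * (2 - t) ^+ 2 = (t * (2 - t)) ^+ 2 by ring.
have p0 : 0 <= t * (2 - t) by nra.
have p1 : t * (2 - t) <= 1 by nra.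
rewrite E; split.
- by apply/andP; split; nra.
- have -> : 2 * t * (2 - t) ^+ 2 + t ^+ 2 * (2 * (2 - t) * -1) =
    4 * (t * (2 - t)) * (1 - t) by ring.
  by rewrite ler_norml; apply/andP; split; nra.
- move=> th; have : 2^-1 <= t * (2 - t) by nra.
  by move: (t * (2 - t)) => w hw; nra.
Qed.

(** The exponent 3 makes it of class C^2, as a cutoff in x must be. *)
Definition xcut (c x : R) : R := pospow 3 (1 - (x - c) ^+ 2).
Definition dxcut (c x : R) : R := 3 * pospow 2 (1 - (x - c) ^+ 2) * (-2 * x + 2 * c).
Definition ddxcut (c x : R) : R :=
  3 * (2 * pospow 1 (1 - (x - c) ^+ 2) * (-2 * x + 2 * c)) * (-2 * x + 2 * c) +
  3 * pospow 2 (1 - (x - c) ^+ 2) * -2.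

Lemma C1fun_parabola (c : R) :
  C1fun (fun x => 1 - (x - c) ^+ 2) (fun x => -2 * x + 2 * c).
Proof.
apply: (C1fun_ext _ _ (C1funD (C1fun_affine 0 1)
  (C1funM (C1fun_affine (-1) c) (C1fun_affine 1 (- c))))) => x; ring.
Qed.

Lemma C1fun_xcut (c : R) : C1fun (xcut c) (dxcut c).
Proof. exact: (C1fun_comp (C1fun_pospow R 1) (C1fun_parabola c)). Qed.

Lemma C1fun_dxcut (c : R) : C1fun (dxcut c) (ddxcut c).
Proof.
exact: (C1funM (C1funZ 3 (C1fun_comp (C1fun_pospow R 0) (C1fun_parabola c)))
  (C1fun_affine (-2) (2 * c))).
Qed.

Lemma xcut_out (c x : R) : 1 <= `|x - c| ->
  [/\ xcut c x = 0, dxcut c x = 0 & ddxcut c x = 0].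
Proof.
move=> xc; have h : 1 - (x - c) ^+ 2 <= 0.
  by rewrite subr_le0 -real_normK ?num_real// exprn_ege1.
rewrite /xcut /dxcut /ddxcut /pospow (max_idPl h).
by rewrite !expr0n !(mulr0, mul0r) addr0.
Qed.

Lemma xcut_bound (c x : R) : `|x - c| <= 1 ->
  [/\ 0 <= xcut c x <= 1, `|dxcut c x| <= 6 & `|ddxcut c x| <= 30].
Proof.
move=> xc; have yy : (x - c) ^+ 2 <= 1 by rewrite -real_normK ?num_real// expr_le1.
have h : 0 <= 1 - (x - c) ^+ 2 by lra.
move: xc; rewrite ler_norml => /andP[y1 y2].
rewrite /xcut /dxcut /ddxcut /pospow (max_idPr h) expr1.
have -> : -2 * x + 2 * c = - 2 * (x - c) by ring.
move: (x - c) y1 y2 yy h => y y1 y2 yy h.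
have w1 : 1 - y ^+ 2 <= 1 by rewrite gerBl sqr_ge0.
have y20 := sqr_ge0 y.
set w := 1 - y ^+ 2 in h w1 *.
have ww : 0 <= w ^+ 2 <= 1 by rewrite sqr_ge0 expr_le1.
case/andP: ww => ww0 ww1.
split.
- by rewrite exprn_ge0//= exprn_ile1.
- by rewrite ler_norml; apply/andP; split; nra.
- have -> : 3 * (2 * w * (- 2 * y)) * (- 2 * y) + 3 * w ^+ 2 * -2 =
     24 * (w * y ^+ 2) - 6 * w ^+ 2 by ring.
  have a0 : 0 <= w * y ^+ 2 by exact: mulr_ge0.
  have a1 : w * y ^+ 2 <= 1 * 1 by exact: ler_pM.
  by rewrite ler_norml; apply/andP; split; lra.
Qed.

Lemma xcut_lower (c x e : R) : e <= 8^-1 -> (x - c) ^+ 2 <= e -> 8^-1 <= xcut c x.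
Proof.
move=> e8 xe; rewrite /xcut /pospow (max_idPr _); last by lra.
apply: (@le_trans _ _ ((2^-1) ^+ 3)).
  by rewrite le_eqVlt; apply/orP; left; apply/eqP; field.
by apply: lerXn2r; rewrite ?nnegrE; lra.
Qed.

Section truncated_focusing.
Variables (g b K e c : R).

(** Backward time from the singular point (1 + e, c), kept positive beyond
    t = 1, where the equation is no longer required. *)
Definition revtime (t : R) : R := floortime e (-1 * t + (1 + e)).
Definition drevtime (t : R) : R := dfloortime e (-1 * t + (1 + e)) * -1.

Definition focus_sol (z : R * R) : R :=
  tcut z.1 * xcut c z.2 * focus g b K c (revtime z.1, z.2).
Definition focus_sol_t (z : R * R) : R :=
  xcut c z.2 * (dtcut z.1 * focus g b K c (revtime z.1, z.2) +
       tcut z.1 * drevtime z.1 * focus_t g b K c (revtime z.1, z.2)).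
Definition focus_sol_x (z : R * R) : R :=
  tcut z.1 * (dxcut c z.2 * focus g b K c (revtime z.1, z.2) +
              xcut c z.2 * focus_x g b K c (revtime z.1, z.2)).
Definition focus_sol_xx (z : R * R) : R :=
  tcut z.1 * (ddxcut c z.2 * focus g b K c (revtime z.1, z.2) +
    2 * dxcut c z.2 * focus_x g b K c (revtime z.1, z.2) +
    xcut c z.2 * focus_xx g b K c (revtime z.1, z.2)).

Lemma revtime_gt0 (t : R) : 0 < e -> 0 < revtime t.
Proof. by move=> e0; apply: lt_le_trans (floortime_ge _ e0); rewrite divr_gt0. Qed.

Lemma focus_sol_C12 : 0 < e -> 0 < b -> C12 focus_sol focus_sol_t focus_sol_x focus_sol_xx.
Proof.
move=> e0 b0.
apply: (C12_product C1fun_tcut (C1fun_xcut c) (C1fun_dxcut c)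
  (C1fun_comp (C1fun_floortime e) (C1fun_affine (-1) (1 + e)))).
  by move=> t; exact: revtime_gt0.
exact: focus_half_C12.
Qed.

Lemma focus_sol_out (t x : R) : ~ (0 <= t <= 2) \/ 1 <= `|x - c| ->
  [/\ focus_sol (t, x) = 0, focus_sol_t (t, x) = 0,
      focus_sol_x (t, x) = 0 & focus_sol_xx (t, x) = 0].
Proof.
rewrite /focus_sol /focus_sol_t /focus_sol_x /focus_sol_xx/=.
case=> [/tcut_out[-> ->]|/xcut_out[-> -> ->]].
  by rewrite !(mul0r, mulr0, addr0).
by rewrite !(mul0r, mulr0, addr0).
Qed.

Lemma focus_sol_W12 (p : R) : 1 <= p -> 0 < e -> 0 < b -> W12_0 p focus_sol.
Proof.
move=> p1 e0 b0; have HU := focus_sol_C12 e0 b0.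
have decay (f : R * R -> R) : continuous f ->
    (forall t x, ~ (0 <= t <= 2) \/ 1 <= `|x - c| -> f (t, x) = 0) -> strip_decay f.
  move=> cf f0; apply: (@strip_decay_compact _ f 2 (`|c| + 1)) => //.
  move=> t x tx; apply: f0; have [tt|tt] := pselect (0 <= t <= 2); last by left.
  right; rewrite leNgt; apply/negP => xc; apply: tx; split=> //.
  rewrite -ler_norml; apply: (@le_trans _ _ (`|x - c| + `|c|)).
    by apply: le_trans (ler_normD _ _); rewrite subrK.
  by rewrite addrC lerD2l ltW.
case: (HU) => -[c1 c2 _] [_ c3 _] [_ c4 _].
apply: (W12_0_intro p1 HU).
- move=> [t x]/= t0; have [->|tN0] := eqVneq t 0; last first.
    have [|//] := @focus_sol_out t x; left => /andP[tt _].
    by have := le_lt_trans tt (_ : t < 0); rewrite ltxx lt_neqAle tN0 t0 => /(_ isT).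
  rewrite /focus_sol/= /tcut.
  have -> : pospow 2 0 = 0 :> R by rewrite /pospow maxxx expr0n.
  by rewrite !mul0r.
- by apply: decay => // t x /focus_sol_out[].
- by apply: decay => // t x /focus_sol_out[].
- by apply: decay => // t x /focus_sol_out[].
- by apply: decay => // t x /focus_sol_out[].
Qed.

(** The quotient u_t / u_xx for the function focus (1 + e - t, x). *)
Definition focus_coef (z : R * R) : R :=
  - focus_t g b K c (1 + e - z.1, z.2) / focus_xx g b K c (1 + e - z.1, z.2).

Lemma revtime_in (t : R) : t < 1 -> revtime t = 1 + e - t /\ drevtime t = -1.
Proof.
move=> t1; rewrite /revtime /drevtime.
have -> : -1 * t + (1 + e) = 1 + e - t by ring.
have [|-> ->] := @floortime_id R e (1 + e - t); first by lra.
by rewrite mul1r.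
Qed.

Hypothesis g12 : 2^-1 < g < 1.
Hypothesis bg : b `^ g = 6 / (g * (2 * g - 1)).
Hypothesis b1 : 1 <= b.
Hypothesis KE : K = b * (g * (2 * g - 1) / 3).
Hypothesis e18 : 0 < e <= 8^-1.

Lemma focus_xx_gt0 (s y : R) : 0 < s -> 0 < focus_xx g b K c (s, y).
Proof.
move=> s0; have [A0 _ /andP[h _]] := focus_bounds c y g12 bg b1 s0.
rewrite KE; apply: lt_le_trans h; rewrite mulr_gt0// divr_gt0//.
by have /andP[g0 g1] := g12; rewrite mulr_gt0//; lra.
Qed.

Lemma focus_coef_bound (z : R * R) : z.1 < 1 ->
  1 <= focus_coef z <= 4 * K / (g * (2 * g - 1)).
Proof.
move=> z1; have /andP[e0 _] := e18; have s0 : 0 < 1 + e - z.1 by lra.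
have /andP[g0 g1] := g12; have G0 : 0 < g * (2 * g - 1) by rewrite mulr_gt0//; lra.
have x0 := focus_xx_gt0 z.2 s0.
have [A0 /andP[t1 t2] /andP[x1 x2]] := focus_bounds c z.2 g12 bg b1 s0.
rewrite -KE in t1 t2 x1 x2; rewrite /focus_coef ler_pdivlMr// mul1r (le_trans x2)//=.
rewrite ler_pdivrMr//; apply: (le_trans t2).
have K0 : 0 <= 4 * K / (g * (2 * g - 1)).
  have b0 : 0 < b by rewrite (lt_le_trans _ b1).
  have Kp : 0 < K by rewrite KE mulr_gt0// divr_gt0.
  by apply: divr_ge0; [apply: mulr_ge0 => //; exact: ltW|exact: ltW].
apply: le_trans (ler_wpM2l K0 x1); rewrite le_eqVlt; apply/orP; left; apply/eqP.
by field; rewrite !gt_eqF//; lra.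
Qed.

Lemma focus_coef_measurable : measurable_fun (@Q R : set (borel_plane R)) focus_coef.
Proof.
have /andP[e0 _] := e18; have b0 : 0 < b by rewrite (lt_le_trans _ b1).
apply: open_continuous_plane_measurable; first exact: open_Q.
move=> [t x]; rewrite inE /Q/= => /andP[t0 t1].
have s0 : 0 < 1 + e - t by lra.
have [_ [_ ct _ cxx]] := focus_half_C12 g K c b0 x s0.
have cs : {for (t, x), continuous (fun z : R * R => (1 + e - z.1, z.2))}.
  apply: (@cvg_pair _ _ _ (nbhs (t, x)) (nbhs (1 + e - t)) (nbhs x) _ _ _
    (fun z : R * R => 1 + e - z.1) snd); last exact: cvg_snd.
  by apply: cvgB; [exact: cvg_cst|exact: cvg_fst].
apply: cvgM.
  by apply: cvgN; apply: (@continuous_comp _ _ _ (fun z : R * R => (1 + e - z.1, z.2))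
    (focus_t g b K c)); [exact: cs|exact: ct].
apply: cvgV; first by rewrite gt_eqF// focus_xx_gt0.
by apply: (@continuous_comp _ _ _ (fun z : R * R => (1 + e - z.1, z.2))
    (focus_xx g b K c)); [exact: cs|exact: cxx].
Qed.

(** By the choice of the coefficient the terms with u_t and u_xx cancel, and
    the remaining ones contain a derivative of a cutoff and at most one
    derivative of focus in x: they are bounded independently of e. The
    hypothesis on a is local, because the coefficient is later shared by
    translates in disjoint cells. *)
Lemma focus_sol_rhs (a : R * R -> R) :
  (forall z, `|z.2 - c| < 1 -> a z = focus_coef z) ->
  forall t x, 0 < t < 1 ->
  `|focus_sol_t (t, x) - (1 * a (t, x) + 1 - 1) * focus_sol_xx (t, x)| <=
  3 * (1 + K) * (4 + 42 * (4 * K / (g * (2 * g - 1)))) *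
  (\1_(`[0, 1]%classic) t * \1_(`[c - 1, c + 1]%classic) x).
Proof.
move=> aE t x /andP[t0 t1]; have /andP[e0 e8] := e18.
have b0 : 0 < b by rewrite (lt_le_trans _ b1).
have G0 : 0 < g * (2 * g - 1) by have /andP[g0 g1] := g12; rewrite mulr_gt0//; lra.
have K0 : 0 < K by rewrite KE mulr_gt0// divr_gt0.
have al0 : 0 <= 4 * K / (g * (2 * g - 1)).
  by apply: divr_ge0; [apply: mulr_ge0 => //; exact: ltW|exact: ltW].
have C0 : 0 <= 3 * (1 + K) * (4 + 42 * (4 * K / (g * (2 * g - 1)))).
  by apply: mulr_ge0; lra.
have [xc|xc] := leP 1 `|x - c|.
  have [|_ -> _ ->] := @focus_sol_out t x; first by right.
  rewrite mulr0 subrr normr0 mulr_ge0// mulr_ge0// indicE; by case: (_ \in _).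
rewrite !indicE mem_set/= ?in_itv/= ?(ltW t0) ?(ltW t1)// mem_set; last first.
  by move: xc; rewrite /= in_itv/= ltr_norml => /andP[? ?]; apply/andP; split; lra.
rewrite !mulr1 aE// mul1r addrK.
have [rt drt] := revtime_in t1.
have s0 : 0 < 1 + e - t by lra.
have x0 := focus_xx_gt0 x s0.
have [/= a1 a2] := andP (@focus_coef_bound (t, x) t1).
have tE : focus_t g b K c (1 + e - t, x) =
    - (focus_coef (t, x) * focus_xx g b K c (1 + e - t, x)).
  by rewrite /focus_coef/= divfK ?opprK// gt_eqF.
rewrite /focus_sol_t /focus_sol_xx/= rt drt tE.
set v := focus _ _ _ _ _; set vx := focus_x _ _ _ _ _; set vxx := focus_xx _ _ _ _ _.
set al := focus_coef _ in a1 a2 *.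
have -> : xcut c x * (dtcut t * v + tcut t * -1 * - (al * vxx)) -
  al * (tcut t * (ddxcut c x * v + 2 * dxcut c x * vx + xcut c x * vxx)) =
  xcut c x * dtcut t * v - al * (tcut t * (ddxcut c x * v + 2 * dxcut c x * vx)) by ring.
have [hv hvx] : `|v| <= 3 * (1 + K) /\ `|vx| <= 3 * (1 + K).
  apply: focus_size => //; [exact: ltW|by apply/andP; split; lra|exact: ltW].
have tt : 0 < t < 1 by rewrite t0.
have [/andP[z0 z1] dz _] := tcut_bound tt.
have [/andP[h0 h1] dh ddh] := xcut_bound (ltW xc).
set M := 3 * (1 + K) in hv hvx C0 *.
apply: (le_trans (ler_normB _ _)).
have -> : M * (4 + 42 * (4 * K / (g * (2 * g - 1)))) =
  1 * 4 * M + 4 * K / (g * (2 * g - 1)) * (1 * (30 * M + 2 * 6 * M)) by ring.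
apply: lerD.
  rewrite (normrM _ v) (normrM (xcut c x)) (ger0_norm h0).
  apply: ler_pM => //; [by rewrite mulr_ge0|exact: ler_pM].
rewrite (normrM al) (normrM (tcut t)) (ger0_norm z0) (ger0_norm (le_trans ler01 a1)).
apply: ler_pM => //; first exact: le_trans ler01 a1.
  by rewrite mulr_ge0.
apply: ler_pM => //; apply: (le_trans (ler_normD _ _)); apply: lerD.
  by rewrite normrM; exact: ler_pM.
rewrite normrM; apply: ler_pM => //.
by rewrite normrM ger0_norm//; apply: ler_wpM2l.
Qed.

(** Near (1, c) the squared parabolic distance to the singular point
    (1 + e, c) is at most 3 e, and the cutoffs are bounded below. The terms with
    derivatives of the cutoffs cost the bounded amount 126 (1 + K). *)
Lemma focus_sol_xx_lower (t x : R) : 1 - e <= t <= 1 - e / 2 ->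
  c <= x <= c + Num.sqrt e ->
  4^-1 * (g * (2 * g - 1) / 32 * (3 * e) `^ (g - 1) - 126 * (1 + K)) <=
  `|focus_sol_xx (t, x)|.
Proof.
move=> /andP[t0 t1] /andP[x0 x1]; have /andP[e0 e8] := e18.
have b0 : 0 < b by rewrite (lt_le_trans _ b1).
have /andP[g0 g1] := g12.
have G0 : 0 < g * (2 * g - 1) by rewrite mulr_gt0//; lra.
have K0 : 0 < K by rewrite KE mulr_gt0// divr_gt0.
have t2 : t < 1 by lra.
have tt : 0 < t < 1 by apply/andP; split; lra.
have [rt _] := revtime_in t2.
have s0 : 0 < 1 + e - t by lra.
have xe : (x - c) ^+ 2 <= e.
  have : (x - c) ^+ 2 <= Num.sqrt e ^+ 2 by apply: lerXn2r; rewrite ?nnegrE; lra.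
  by rewrite sqr_sqrtr// ltW.
have xc : `|x - c| <= 1.
  have h : `|x - c| ^+ 2 <= 1 by rewrite real_normK ?num_real//; lra.
  have := normr_ge0 (x - c); nra.
have [/andP[z0 z1] dz zl] := tcut_bound tt.
have zl' : 4^-1 <= tcut t by apply: zl; lra.
have hl := xcut_lower e8 xe.
have [_ dh ddh] := xcut_bound xc.
have [hv hvx] : `|focus g b K c (1 + e - t, x)| <= 3 * (1 + K) /\
    `|focus_x g b K c (1 + e - t, x)| <= 3 * (1 + K).
  apply: focus_size => //; [exact: ltW|by apply/andP; split; lra].
have [A0 _ /andP[x2 _]] := focus_bounds c x g12 bg b1 s0.
rewrite -KE in x2.
have AE : (3 * e) `^ (g - 1) <= parab_pow 1 c (g - 1) (1 + e - t, x).
  rewrite /parab_pow/= mul1r; apply: powR_anti; [by lra| |by lra].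
  by rewrite ltr_wpDr// divr_ge0// sqr_ge0.
have A30 : 0 <= (3 * e) `^ (g - 1) by exact: powR_ge0.
rewrite /focus_sol_xx/= rt.
move: hv hvx x2; set v := focus _ _ _ _ _; set vx := focus_x _ _ _ _ _.
set vxx := focus_xx _ _ _ _ _ => hv hvx x2.
set M := 3 * (1 + K) in hv hvx *.
have -> : 126 * (1 + K) = 30 * M + 2 * 6 * M by rewrite /M; ring.
have M0 : 0 <= M by rewrite /M; lra.
set m := _ - _; have [m0|m0] := leP m 0.
  by apply: (@le_trans _ _ 0) => //; lra.
rewrite normrM (ger0_norm z0); apply: ler_pM => //; first exact: ltW.
set X := ddxcut c x * v; set Y := 2 * dxcut c x * vx; set Z := xcut c x * vxx.
have hX : `|X| <= 30 * M by rewrite normrM; exact: ler_pM.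
have hY : `|Y| <= 2 * 6 * M.
  by rewrite normrM; apply: ler_pM => //; rewrite normrM ger0_norm//; apply: ler_wpM2l.
have hZ : g * (2 * g - 1) / 32 * (3 * e) `^ (g - 1) <= Z.
  have -> : g * (2 * g - 1) / 32 * (3 * e) `^ (g - 1) =
      8^-1 * (g * (2 * g - 1) / 4 * (3 * e) `^ (g - 1)) by field.
  have G4 : 0 <= g * (2 * g - 1) / 4 by lra.
  apply: ler_pM => //; first by rewrite mulr_ge0.
  by apply: le_trans x2; exact: ler_wpM2l.
apply: le_trans (ler_norm _); rewrite /m.
by move: hX hY; rewrite !ler_norml => /andP[? ?] /andP[? ?]; lra.
Qed.

End truncated_focusing.
End focusing_cutoff.

(** * Exponents above 3 *)

Section focusing_cells.
Variable R : realType.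
Variables g b K : R.

(** The strip is cut into cells of width 2; the cell of index n carries the
    construction with centre 2 n + 1 and e = 1 / (n + 8), so that one coefficient
    serves arbitrarily small e. The first cell also takes all negative x, on
    which the truncation of x / 2 is 0. *)
Definition cell_index (x : R) : nat := Num.truncn (x / 2).
Definition cell_center (n : nat) : R := 2 * n%:R + 1.
Definition cell_scale (n : nat) : R := (n%:R + 8)^-1.

Definition gluedcoef (z : R * R) : R :=
  focus_coef g b K (cell_scale (cell_index z.2)) (cell_center (cell_index z.2)) z.

Lemma cell_scale_itv (n : nat) : 0 < cell_scale n <= 8^-1.
Proof.
have n0 : 0 <= n%:R :> R by exact: ler0n.
have n8 : 0 < n%:R + 8 :> R by lra.
by rewrite /cell_scale invr_gt0 n8 lef_pV2 ?posrE//= lerDr.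
Qed.

Lemma cell_index_center (n : nat) (x : R) :
  `|x - cell_center n| < 1 -> cell_index x = n.
Proof.
rewrite /cell_center ltr_norml => /andP[x1 x2]; apply: truncn_def.
have nS : n.+1%:R = n%:R + 1 :> R by rewrite natr1.
by rewrite nS; apply/andP; split; lra.
Qed.

Definition cell (n : nat) : set R :=
  if n is n'.+1 then `[2 * n%:R, 2 * n%:R + 2[%classic else `]-oo, 2[%classic.

Lemma cell_index_cell (n : nat) (x : R) : cell n x -> cell_index x = n.
Proof.
case: n => [|n]; rewrite /cell /= in_itv/=.
  by move=> x2; apply/truncn0Pn; rewrite -ltNge; lra.
move=> /andP[x1 x2]; apply: truncn_def.
have nS : n.+2%:R = n.+1%:R + 1 :> R by rewrite natr1.
by rewrite nS; apply/andP; split; lra.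
Qed.

Lemma cell_cover (x : R) : cell (cell_index x) x.
Proof.
have [x2|x2] := ltP x 2.
  have -> : cell_index x = 0%N by apply: cell_index_cell; rewrite /= in_itv.
  by rewrite /= in_itv.
have x0 : 0 <= x / 2 by lra.
have := truncn_itv x0; rewrite -/(cell_index x) => /andP[n1 n2].
have : (0 < cell_index x)%N by rewrite truncn_gt0; lra.
case: (cell_index x) n1 n2 => // n n1 n2 _; rewrite /cell /= in_itv/=.
have nS : n.+2%:R = n.+1%:R + 1 :> R by rewrite natr1.
by move: n2; rewrite nS => n2; apply/andP; split; lra.
Qed.

Hypothesis g12 : 2^-1 < g < 1.
Hypothesis bg : b `^ g = 6 / (g * (2 * g - 1)).
Hypothesis b1 : 1 <= b.
Hypothesis KE : K = b * (g * (2 * g - 1) / 3).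

(** The bounds hold in each cell with the same constants; measurability follows
    since there are countably many cells. *)
Lemma gluedcoef_class : coef_class 1 (4 * K / (g * (2 * g - 1))) gluedcoef.
Proof.
split; last first.
  move=> z /andP[_ z1]; apply: focus_coef_bound => //; exact: cell_scale_itv.
pose E (n : nat) : set (borel_plane R) := (setT `*` cell n) `&` @Q R.
have mc n : measurable (cell n : set (measurableTypeR R)).
  by case: n => [|n]; exact: measurable_itv.
have mE n : measurable (E n).
  by apply: measurableI; [apply: measurableX|exact: measurable_Q].
have -> : (@Q R : set (borel_plane R)) = \bigcup_n E n.
  apply/seteqP; split => [z Qz|z [n _ []//]].
  by exists (cell_index z.2) => //; split=> //; split=> //; exact: cell_cover.
apply/(measurable_fun_bigcup _ mE) => n.
apply: (eq_measurable_fun (focus_coef g b K (cell_scale n) (cell_center n))).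
  by move=> z; rewrite inE => -[[_ /= zn] _]; rewrite /gluedcoef (cell_index_cell zn).
apply: (@measurable_funS _ _ (borel_plane R) _ _ _ _ (@measurable_Q R)); first by move=> z [].
by apply: focus_coef_measurable => //; exact: cell_scale_itv.
Qed.

End focusing_cells.

(** On a box of measure of order e^(3/2) the derivative u_xx is of order
    e^(g-1), while the right-hand side is bounded. The norm of u_xx grows without
    bound as soon as 1 - g > 3/(2p), which together with g > 1/2 is possible
    exactly because p > 3. *)
Lemma estimate_fails_gt3 (R : realType) (p : R) (hp : 3 < p) :
  exists (alpha : R) (a : R * R -> R),
    [/\ 1 < alpha, coef_class 1 alpha a & estimate_fails p a].
Proof.
have p0 : 0 < p by lra.
pose ip := p^-1; have ip0 : 0 < ip by rewrite invr_gt0.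
have ip3 : ip < 3^-1 by rewrite ltf_pV2 ?posrE.
(* The midpoint between 1/2 and 1 - 3/(2p). *)
pose g := 3 / 4 - 3 / 4 * ip.
have g12 : 2^-1 < g < 1 by rewrite /g; apply/andP; split; lra.
have /andP[g0 g1] := g12.
pose eta := 1 - g - 3 / 2 * ip.
have eta0 : 0 < eta by rewrite /eta /g; lra.
pose G := g * (2 * g - 1).
have G0 : 0 < G by rewrite mulr_gt0//; lra.
have G1 : G <= 1 by rewrite /G; nra.
pose b := (6 / G) `^ g^-1.
have bg : b `^ g = 6 / G.
  by rewrite -powRrM mulVf ?powRr1 ?gt_eqF// ?divr_ge0 ?ltW//; lra.
have b1 : 1 <= b.
  have -> : 1 = 1 `^ g^-1 :> R by rewrite powR1.
  apply: ge0_ler_powR; rewrite ?nnegrE ?invr_ge0//; [by lra| |].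
    by rewrite divr_ge0// ltW.
  by rewrite ler_pdivlMr//; lra.
have b0 : 0 < b by lra.
pose K := b * (G / 3).
have K0 : 0 < K by rewrite mulr_gt0// divr_gt0.
have KE : K = b * (g * (2 * g - 1) / 3) by [].
pose al := 4 * K / G.
have alE : al = 4 / 3 * b by rewrite /al /K; field; rewrite gt_eqF.
exists al, (gluedcoef g b K); split.
- by rewrite alE; lra.
- exact: gluedcoef_class.
move=> N N0.
pose Cf := 3 * (1 + K) * (4 + 42 * al).
have Cf0 : 0 < Cf by rewrite mulr_gt0//; [lra|rewrite alE; lra].
pose h := 2^-1 `^ ip; have h0 : 0 < h by rewrite powR_gt0.
pose k1 := G / 32 * 3 `^ (g - 1).
have k10 : 0 < k1 by rewrite mulr_gt0 ?powR_gt0//; lra.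
pose X := N * (Cf * (1 * 2) `^ ip).
have X0 : 0 <= X by exact: mulr_ge0 (ltW N0) (mulr_ge0 (ltW Cf0) (powR_ge0 _ _)).
pose B := (4 * X / h + 126 * (1 + K)) / k1.
have B0 : 0 <= B.
  apply: divr_ge0; last exact: ltW.
  by apply: addr_ge0; [apply: divr_ge0; [lra|exact: ltW]|lra].
have [e' /andP[e0' e8'] Be'] := small_powR eta0 B0 ltr01.
pose n := Num.truncn e'^-1.
pose e := cell_scale R n; pose c := cell_center R n.
have e18 : 0 < e <= 8^-1 by exact: cell_scale_itv.
have /andP[e0 e8] := e18.
have ee' : e <= e'.
  rewrite -[e']invrK /e /cell_scale lef_pV2 ?posrE ?invr_gt0//.
  have nS : n.+1%:R = n%:R + 1 :> R by rewrite natr1.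
  by have := real_truncnS_gt (num_real e'^-1); rewrite -/n nS; lra.
have Be : B * e `^ eta < 1.
  apply: le_lt_trans Be'; apply: ler_wpM2l => //.
  by apply: ge0_ler_powR; rewrite ?nnegrE// ltW.
have HU := focus_sol_C12 g K c e0 b0.
exists (focus_sol g b K e c), (focus_sol_t g b K e c), (focus_sol_xx g b K e c), 1; split.
- by apply: focus_sol_W12 => //; lra.
- by rewrite ler01 lexx.
- exact: C12_dt_Q HU.
- exact: C12_dxx_Q HU.
have [mt mxx] := C12_measurable_Q HU.
pose m := 4^-1 * (G / 32 * (3 * e) `^ (g - 1) - 126 * (1 + K)).
have pw (u v : R) : e `^ (u + v) = e `^ u * e `^ v.
  by rewrite powRD//; apply/implyP => _; rewrite gt_eqF.
have area : ((1 - e / 2 - (1 - e)) * (c + Num.sqrt e - c)) `^ ip =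
    h * e `^ (3 / 2 * ip).
  have -> : (1 - e / 2 - (1 - e)) * (c + Num.sqrt e - c) = 2^-1 * e `^ (3 / 2).
    have -> : 3 / 2 = 1 + 2^-1 :> R by field.
    by rewrite pw powRr1 ?(ltW e0)// powR12_sqrt ?(ltW e0)//; field.
  by rewrite powRM ?powR_ge0// -powRrM.
have gap : X < m * (h * e `^ (3 / 2 * ip)).
  have e1 : e `^ (3 / 2 * ip) <= 1.
    have := @ger_powR _ e _ 0 (3 / 2 * ip); rewrite powRr0; apply; first by rewrite e0; lra.
    by lra.
  have e2 : 0 < e `^ (3 / 2 * ip) by rewrite powR_gt0.
  have main : 4 * X / h + 126 * (1 + K) < k1 * (e `^ (g - 1) * e `^ (3 / 2 * ip)).
    rewrite -pw.
    have -> : g - 1 + 3 / 2 * ip = - eta by rewrite /eta; ring.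
    rewrite powRN ltr_pdivlMr ?powR_gt0//.
    move: Be; rewrite /B mulrAC ltr_pdivrMr// mul1r.
    done.
  have -> : m * (h * e `^ (3 / 2 * ip)) =
    4^-1 * h * (k1 * (e `^ (g - 1) * e `^ (3 / 2 * ip)) - 126 * (1 + K) * e `^ (3 / 2 * ip)).
    by rewrite /m powRM ?(ltW e0)// /k1; ring.
  have XE : X = 4^-1 * h * (4 * X / h) by field; rewrite gt_eqF.
  rewrite {1}XE ltr_pM2l ?mulr_gt0//.
  have : 126 * (1 + K) * e `^ (3 / 2 * ip) <= 126 * (1 + K) * 1.
    by apply: ler_wpM2l => //; lra.
  by lra.
have m0 : 0 <= m.
  have hh : 0 < h * e `^ (3 / 2 * ip) by rewrite mulr_gt0 ?powR_gt0.
  by rewrite -(pmulr_lge0 _ hh) ltW// (le_lt_trans X0).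
apply: (@LpQ_norm_gap _ p _ _ (\1_(`[c - 1, c + 1]%classic))
  Cf 1 2 m (1 - e) (1 - e / 2) c (c + Num.sqrt e) N) => //.
- by lra.
- exact: ltW.
- by lra.
- by lra.
- by lra.
- by rewrite lerDl sqrtr_ge0.
- exact: ltW.
- exact: (measurable_rhs _ (gluedcoef_class g12 bg b1 KE)).
- by move=> x; rewrite indicE; case: (_ \in _); rewrite lexx ler01.
- rewrite integral_indic// setIT.
  have c11 : c - 1 <= c + 1 by lra.
  have := lebesgue_segment c11.
  by have -> : c + 1 - (c - 1) = 2 by ring.
- move=> t x tt; apply: (focus_sol_rhs g12 bg b1 KE e18) => // z zc.
  by rewrite /gluedcoef (cell_index_center zc).
- by move=> t x tt xx; exact: focus_sol_xx_lower.
by rewrite area.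
Qed.

(** * Failure of the estimate *)

Theorem corollary2p4 (R : realType) (p : R)
    (hp : 1 < p < 3 / 2 \/ 3 < p) :
  exists (alpha : R) (a : R * R -> R),
    [/\ 1 < alpha,
        coef_class 1 alpha a &
        forall N : R, 0 < N ->
          exists (u ut uxx : R * R -> R) (lambda : R),
            [/\ W12_0 p u, 0 <= lambda <= 1, is_dt (@Q R) u ut,
                is_dxx (@Q R) u uxx &
                ~ (LpQ_norm p uxx <=
                   N%:E * LpQ_norm p (fun z =>
                     ut z - (lambda * a z + 1 - lambda) * uxx z)%R)%E]].
Proof. by case: hp; [exact: estimate_fails_lt32|exact: estimate_fails_gt3]. Qed.
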